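(* Let $k$ be an integer between $3$ and $n$. Suppose we have a $(p,k)$-isolating parallelepiped $(V,\boldsymbol{u})$ for some $p=p(n)\in[1,\infty)$ and can make quantum queries to oracles $O_V:|i\rangle|s\rangle|0\rangle\to|i\rangle|s\rangle|V_{is}\rangle$ and $O_{\boldsymbol{u}}:|i\rangle|0\rangle\to|i\rangle|\boldsymbol{u}_i\rangle$ for $i\in[2^k]$ and $s\in[k]$. Then for every given input oracle $O_\Phi:|j\rangle|w\rangle|0\rangle\to|j\rangle|w\rangle|C_w(j)\rangle$ ($w\in[m]$, $j\in[n]$) of a $k$-CNF formula $\psi=C_1\wedge C_2\wedge\cdots\wedge C_m$ with $m$ clauses on $n$ variables, one can output oracles $O_{\mathbf{B}}:|h\rangle|j\rangle|0\rangle\to|h\rangle|j\rangle|\mathbf{B}_j(h)\rangle$ of a basis $\mathbf{B}\in\mathbb{R}^{(m\cdot2^k+n)\times n}$ for each $h\in[m\cdot 2^k+n]$ and $j\in[n]$, $O_{\boldsymbol{t}}:|h\rangle|0\rangle\to|h\rangle|t_h\rangle$ of a target vector $\boldsymbol{t}\in\mathbb{R}^{m\cdot 2^k+n}$ for each $h\in[m\cdot 2^k+n]$, and a radius $r$ such that $$|\mathrm{sol}(\psi)|=\mathrm{VCP}_p(\mathbf{B},\boldsymbol{t},r),$$ using $\mathrm{poly}(n,m)$ queries to $O_V,O_V^\dagger,O_{\boldsymbol{u}},O_{\boldsymbol{u}}^\dagger,O_\Phi,O_\Phi^\dagger$ and elementary gates.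
   Context: $\|\cdot\|_p$ is the $\ell_p$ norm and $B^d_p\subset\mathbb{R}^d$ its closed unit ball. For $1\le p\le\infty$ and $3\le k\le n$, $V\in\mathbb{R}^{2^k\times k}$ and $\boldsymbol{u}\in\mathbb{R}^{2^k}$ define a $(p,k)$-isolating parallelepiped if $\|\boldsymbol{u}\|_p>1$ and $\|V\boldsymbol{x}-\boldsymbol{u}\|_p=1$ for all $\boldsymbol{x}\in\{0,1\}^k\setminus\{0\}$. A $k$-CNF formula is a CNF formula in which every clause has at most $k$ literals. $C_w(j)$ encodes how the variable $x_j$ occurs in clause $C_w$ (positively, negatively, or not at all). $\mathrm{sol}(\psi)$ is the set of satisfying assignments of $\psi$. $\mathbf{B}_j(h)$ is the $h$-th coordinate of the $j$-th basis vector (column) of $\mathbf{B}$. For a basis $\mathbf{B}\in\mathbb{R}^{d\times n}$ (linearly independent columns) generating the lattice $\mathcal{L}=\mathbf{B}\mathbb{Z}^n$, a target $\boldsymbol{t}\in\mathbb{R}^d$ and radius $r>0$, $\mathrm{VCP}_p(\mathbf{B},\boldsymbol{t},r)=|(\mathcal{L}-\boldsymbol{t})\cap r\cdot B^d_p|$. *)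

(* Defs.v *)
From HB Require Import structures.
From mathcomp Require Import all_boot all_order all_algebra.
From mathcomp Require Import all_classical all_reals all_analysis.
From mathcomp Require Import complex.

Set Implicit Arguments.
Unset Strict Implicit.
Unset Printing Implicit Defensive.

Import Order.TTheory GRing.Theory Num.Theory.
Local Open Scope ring_scope.

(** * Lattices *)

Definition lp_norm (R : realType) (d : nat) (p : R) (x : 'cV[R]_d) : R :=
  (\sum_(i < d) `|x i 0| `^ p) `^ p^-1.

Definition is_basis (R : realType) (d n : nat) (B : 'M[R]_(d, n)) : Prop :=
  row_free B^T.

Definition lattice (R : realType) (d n : nat) (B : 'M[R]_(d, n))
    : set 'cV[R]_d :=
  [set v | exists z : 'cV[int]_n, v = B *m map_mx intr z]%classic.

(* [counting] is the cardinality of a set, with value +oo on infinite sets. *)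
Definition VCP (R : realType) (d n : nat) (p : R) (B : 'M[R]_(d, n))
    (t : 'cV[R]_d) (r : R) : \bar R :=
  counting [set v : 'cV[R]_d | lattice B (v + t) /\ lp_norm p v <= r]%classic.

Definition isolating (R : realType) (k : nat) (p : R)
    (V : 'M[R]_(2 ^ k, k)) (u : 'cV[R]_(2 ^ k)) : Prop :=
  1 < lp_norm p u /\
  forall x : {ffun 'I_k -> bool}, (exists s, x s) ->
    lp_norm p (V *m \col_s (x s)%:R - u) = 1.

(** * CNF formulas *)

(* [C j] is [Some true] if x_j occurs positively in the clause C, [Some false]
   if it occurs negatively, and [None] if it does not occur. *)
Definition clause (n : nat) := {ffun 'I_n -> option bool}.
Definition cnf (n m : nat) := {ffun 'I_m -> clause n}.

Definition is_kcnf (n m k : nat) (psi : cnf n m) : Prop :=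
  forall w, (#|[set j | psi w j != None]| <= k)%N.

Definition sol (n m : nat) (psi : cnf n m) : {set {ffun 'I_n -> bool}} :=
  [set x : {ffun _} | [forall w, [exists j, psi w j == Some (x j)]]].

(** * Quantum registers holding qubits and real numbers *)

(* Labels of the computational basis of a memory with q qubits and r
   real-valued registers. *)
Notation config R q r :=
  ({ffun 'I_q -> bool} * {ffun 'I_r -> Real.sort R})%type.

(* Amplitudes. The Hilbert space is l^2 (config R q r), i.e. the states that
   satisfy [square_summable] below; operators are given by functions on all
   amplitude families and are only constrained on l^2. *)
Notation state R q r := (config R q r -> (Real.sort R)[i]).

Definition ket (R : realType) (q r : nat) (c : config R q r) : state R q r :=
  fun c' => (c' == c)%:R.

(* Registers beyond the end of the lists hold 0. *)
Definition conf (R : realType) (q r : nat) (s : seq bool) (t : seq R)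
    : config R q r :=
  ([ffun i : 'I_q => nth false s i], [ffun i : 'I_r => nth 0 t i]).

Definition sqnorm (R : realType) (q r : nat) (f : state R q r) : \bar R :=
  \esum_(c in [set: config R q r]) ((complex.Re (f c) ^+ 2 + complex.Im (f c) ^+ 2)%:E).

Definition square_summable (R : realType) (q r : nat) (f : state R q r) : Prop :=
  (sqnorm f < +oo)%E.

Record operator (R : realType) (q r : nat) := Operator {
  fwd : state R q r -> state R q r;
  adj : state R q r -> state R q r }.

(* A linear surjective isometry of l^2, together with its adjoint (= inverse). *)
Record unitary (R : realType) (q r : nat) (U : operator R q r) : Prop := {
  unitary_linear : forall (a : R[i]) (f g : state R q r),
    square_summable f -> square_summable g ->
    fwd U (fun c => a * f c + g c) = (fun c => a * fwd U f c + fwd U g c);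
  unitary_sqnorm : forall f, square_summable f -> sqnorm (fwd U f) = sqnorm f;
  unitary_adj_l2 : forall f, square_summable f -> square_summable (adj U f);
  unitary_fwdK : forall f, square_summable f -> adj U (fwd U f) = f;
  unitary_adjK : forall f, square_summable f -> fwd U (adj U f) = f }.

Definition dagger (R : realType) (q r : nat) (U : operator R q r) :=
  Operator (adj U) (fwd U).

Record emb (a q : nat) := Emb {
  emb_fun :> 'I_a -> 'I_q;
  emb_inj : injective emb_fun }.

Definition read (R : realType) (a b q r : nat) (f : emb a q) (g : emb b r)
    (c : config R q r) : config R a b :=
  ([ffun i => c.1 (f i)], [ffun i => c.2 (g i)]).

Definition write (R : realType) (a b q r : nat) (f : emb a q) (g : emb b r)
    (l : config R a b) (c : config R q r) : config R q r :=
  ([ffun x => if [pick i | f i == x] is Some i then l.1 i else c.1 x],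
   [ffun y => if [pick i | g i == y] is Some i then l.2 i else c.2 y]).

(* U tensored with the identity: U acts on the qubits f 0, f 1, ... and on the
   real registers g 0, g 1, ... *)
Definition act_on (R : realType) (a b q r : nat) (f : emb a q) (g : emb b r)
    (U : state R a b -> state R a b) : state R q r -> state R q r :=
  fun psi c => U (fun l => psi (write f g l c)) (read f g c).

(** * Elementary gates *)

(* [perm_op s s'] maps |c> to |s c>, where s' is the inverse of s. *)
Definition perm_op (R : realType) (q r : nat)
    (s s' : config R q r -> config R q r) : operator R q r :=
  Operator (fun f c => f (s' c)) (fun f c => f (s c)).

Definition set_bit (R : realType) (q r : nat) (i : 'I_q) (b : bool)
    (c : config R q r) : config R q r :=
  ([ffun j => if j == i then b else c.1 j], c.2).

Definition xor_bit (R : realType) (q r : nat) (i : 'I_q) (b : bool)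
    (c : config R q r) : config R q r :=
  set_bit i (c.1 i (+) b) c.

Definition add_real (R : realType) (q r : nat) (i : 'I_r) (x : R)
    (c : config R q r) : config R q r :=
  (c.1, [ffun j => if j == i then c.2 j + x else c.2 j]).

(* |x_0>...|x_(r-1)> |-> |x_0>...|x_i + F x>...; F must not depend on x_i. *)
Definition add_op (R : realType) (q r : nat) (i : 'I_r)
    (F : config R q r -> R) : operator R q r :=
  perm_op (fun c => add_real i (F c) c) (fun c => add_real i (- F c) c).

Definition xor_op (R : realType) (q r : nat) (i : 'I_q)
    (F : config R q r -> bool) : operator R q r :=
  perm_op (fun c => xor_bit i (F c) c) (fun c => xor_bit i (F c) c).

Definition hadamard (R : realType) : operator R 1 0 :=
  let U := fun (f : state R 1 0) c =>
    (Num.sqrt 2)^-1%:C%C *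
      (f (set_bit 0 false c) + (-1) ^+ c.1 0 * f (set_bit 0 true c)) in
  Operator U U.

Definition phase_T (R : realType) : operator R 1 0 :=
  let s : R := (Num.sqrt 2)^-1 in
  Operator (fun f c => (if c.1 0 then Complex s s else 1) * f c)
           (fun f c => (if c.1 0 then Complex s (- s) else 1) * f c).

(* Qubit gates: X, H, T = diag(1, e^(i pi/4)), CNOT, Toffoli.
   Gates involving real registers:
     GInc :  |x>       |-> |x + 1>
     GAdd :  |b>|x>|y> |-> |b>|x>|y + b x>       (b a control qubit)
     GMul :  |x>|y>|z> |-> |x>|y>|z + x y>
     GPow :  |x>|y>    |-> |x>|y + |x|^p>
     GRoot : |x>|y>    |-> |x>|y + |x|^(1/p)>
   There is no gate loading an arbitrary real constant. *)
Inductive gate :=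
  GX | GH | GT | GCNOT | GToffoli | GInc | GAdd | GMul | GPow | GRoot.

Definition gate_qubits (g : gate) : nat :=
  match g with
  | GX | GH | GT => 1 | GCNOT => 2 | GToffoli => 3
  | GAdd => 1 | GInc | GMul | GPow | GRoot => 0
  end%N.

Definition gate_reals (g : gate) : nat :=
  match g with
  | GX | GH | GT | GCNOT | GToffoli => 0
  | GInc => 1 | GAdd => 2 | GMul => 3 | GPow | GRoot => 2
  end%N.

Definition gate_op (R : realType) (p : R) (g : gate)
    : operator R (gate_qubits g) (gate_reals g) :=
  match g with
  | GX => @xor_op R 1 0 (inord 0) (fun=> true)
  | GH => hadamard R
  | GT => phase_T R
  | GCNOT => @xor_op R 2 0 (inord 1) (fun c => c.1 (inord 0))
  | GToffoli =>
      @xor_op R 3 0 (inord 2) (fun c => c.1 (inord 0) && c.1 (inord 1))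
  | GInc => @add_op R 0 1 (inord 0) (fun=> 1)
  | GAdd =>
      @add_op R 1 2 (inord 1) (fun c => (c.1 (inord 0))%:R * c.2 (inord 0))
  | GMul => @add_op R 0 3 (inord 2) (fun c => c.2 (inord 0) * c.2 (inord 1))
  | GPow => @add_op R 0 2 (inord 1) (fun c => `|c.2 (inord 0)| `^ p)
  | GRoot => @add_op R 0 2 (inord 1) (fun c => `|c.2 (inord 0)| `^ p^-1)
  end.

(** * Oracles *)

(* Number of qubits of an index register over a set of N elements, and the
   little-endian L-bit binary expansion of x; indices start at 0. *)
Definition lg (N : nat) : nat := up_log 2 N.
Definition bin (L x : nat) : seq bool := mkseq (fun b => odd (x %/ 2 ^ b)) L.

(* Two-qubit encoding of C_w(j): does x_j occur, and does it occur positively. *)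
Definition occ_code (o : option bool) : seq bool :=
  [:: o != None; o == Some true].

Inductive query := QV | Qu | QPhi.

Definition query_qubits (n m k : nat) (x : query) : nat :=
  match x with QV => k + lg k | Qu => k | QPhi => lg n + lg m + 2 end%N.

Definition query_reals (x : query) : nat :=
  match x with QV | Qu => 1 | QPhi => 0 end%N.

Definition oracles (R : realType) (n m k : nat) :=
  forall x : query, operator R (query_qubits n m k x) (query_reals x).

(* The oracles are arbitrary unitaries with the prescribed action on inputs
   whose answer register is |0>. *)
Definition oracles_for (R : realType) (n m k : nat) (V : 'M[R]_(2 ^ k, k))
    (u : 'cV[R]_(2 ^ k)) (psi : cnf n m) (O : oracles R n m k) : Prop :=
  [/\ forall x, unitary (O x),
      forall (i : 'I_(2 ^ k)) (s : 'I_k),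
        fwd (O QV) (ket (conf _ _ (bin k i ++ bin (lg k) s) [:: 0])) =
        ket (conf _ _ (bin k i ++ bin (lg k) s) [:: V i s]),
      forall i : 'I_(2 ^ k),
        fwd (O Qu) (ket (conf _ _ (bin k i) [:: 0])) =
        ket (conf _ _ (bin k i) [:: u i 0]) &
      forall (j : 'I_n) (w : 'I_m),
        fwd (O QPhi)
          (ket (conf _ _ (bin (lg n) j ++ bin (lg m) w) [::])) =
        ket (conf _ _
          (bin (lg n) j ++ bin (lg m) w ++ occ_code (psi w j)) [::])].

(** * Query circuits *)

Definition op_qubits (n m k : nat) (x : gate + query) : nat :=
  match x with inl g => gate_qubits g | inr y => query_qubits n m k y end.

Definition op_reals (x : gate + query) : nat :=
  match x with inl g => gate_reals g | inr y => query_reals y end.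

Definition op_sem (R : realType) (n m k : nat) (p : R) (O : oracles R n m k)
    (x : gate + query) : operator R (op_qubits n m k x) (op_reals x) :=
  match x with inl g => gate_op p g | inr y => O y end.

(* One application of a gate or oracle, or of its adjoint if [inv] holds, to
   the indicated registers. *)
Record instr (n m k q r : nat) := Instr {
  op : gate + query;
  inv : bool;
  qubits : emb (op_qubits n m k op) q;
  reals : emb (op_reals op) r }.

Definition instr_sem (R : realType) (n m k q r : nat) (p : R)
    (O : oracles R n m k) (I : instr n m k q r) : state R q r -> state R q r :=
  let U := op_sem p O (op I) in
  act_on (qubits I) (reals I) (fwd (if inv I then dagger U else U)).

(* A circuit with an input register of l qubits, an output register holding a
   real number (real register 0), and ancillas. *)
Record circuit (n m k l : nat) := Circuit {
  anc_qubits : nat;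
  anc_reals : nat;
  body : seq (instr n m k (l + anc_qubits) anc_reals.+1) }.

(* Total number of queries and elementary gates. *)
Definition cost (n m k l : nat) (C : circuit n m k l) : nat := size (body C).

Definition run (R : realType) (n m k l : nat) (p : R) (O : oracles R n m k)
    (C : circuit n m k l) (psi : state R (l + anc_qubits C) (anc_reals C).+1) :=
  foldl (fun phi I => instr_sem p O I phi) psi (body C).

(* The circuit maps |s>|0> to |s>|x>; its ancillas start and end in |0>. *)
Definition outputs (R : realType) (n m k l : nat) (p : R) (O : oracles R n m k)
    (C : circuit n m k l) (s : seq bool) (x : R) : Prop :=
  run p O (ket (conf (l + anc_qubits C) (anc_reals C).+1 s [:: 0])) =
  ket (conf (l + anc_qubits C) (anc_reals C).+1 s [:: x]).

(* Main.v *)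
(** All circuits permute computational basis states only. All answers of the
    oracles on the relevant indices are loaded into fresh registers; every
    further quantity is a sum of products, powers and roots of earlier ones and
    is added to its own fresh register; the result is added to the output
    register, and everything else is undone.

    A variable occurring in a clause is given the slot equal to the number of
    occurring variables before it. Row block w of the basis carries, in column
    j, plus or minus the column of V in the slot of x_j, and the target carries
    u minus the columns of the negative literals, so that a 0/1 vector x yields
    V y - u, where y is the vector of truth values of the literals of clause w.
    This block has norm 1 if the clause holds and norm ||u|| > 1 otherwise. The
    last n rows, 2(m+1) times the identity with target m+1, contribute
    n (m+1)^p on 0/1 vectors and exceed this by more than m on all other integer
    vectors, so r^p = m + n (m+1)^p selects exactly the satisfying assignments. *)

From HB Require Import structures.
Require Import Defs.
From mathcomp Require Import all_boot all_order all_algebra.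
From mathcomp Require Import all_classical all_reals all_analysis.
From mathcomp Require Import complex finmap ring lra zify.

Set Implicit Arguments.
Unset Strict Implicit.
Unset Printing Implicit Defensive.

Import Order.TTheory GRing.Theory Num.Theory.
Local Open Scope ring_scope.

(** * Basis states and named registers *)

Section Kets.
Context {R : realType}.

Lemma square_summable0 q r : square_summable (fun _ : config R q r => 0).
Proof.
by rewrite /square_summable /sqnorm esum1 ?ltry // => c _; rewrite /= expr0n addr0.
Qed.

Lemma square_summable_ket q r (c : config R q r) : square_summable (ket c).
Proof.
rewrite /square_summable /sqnorm.
rewrite (_ : \esum_(_ in _) _ = \esum_(c' in [set c]%classic) (1%:E : \bar R))%E.
  by rewrite esum_set1 ?ltry // lee_fin.
rewrite [RHS]esum_mkcond; apply: eq_esum => c' _; rewrite /ket in_set1.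
by case: (c' == c); rewrite /= ?expr1n ?expr0n addr0.
Qed.

(** On a branch whose untouched registers differ from those of the given basis state, [act_on] feeds
    the zero family to the operator, so its value at 0 matters too. *)
Definition preserves0 q r (U : operator R q r) :=
  fwd U (fun=> 0) = (fun=> 0) /\ adj U (fun=> 0) = (fun=> 0).

Definition maps q r (U : operator R q r) (c c' : config R q r) :=
  fwd U (ket c) = ket c' /\ adj U (ket c') = ket c.

Lemma unitary_preserves0 q r (U : operator R q r) : unitary U -> preserves0 U.
Proof.
move=> uU; have s0 := square_summable0 q r.
have U0 : fwd U (fun=> 0) = (fun=> 0).
  (* Linearity at $0 = 1\cdot 0 + 0$ gives $U0 = U0 + U0$. *)
  have /= := unitary_linear uU 1 s0 s0.
  rewrite mulr0 addr0 => /(congr1 (fun f => fun c => f c - fwd U (fun=> 0) c)) E.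
  by apply: funext => c; move: (congr1 (fun f => f c) E) => /=; rewrite mul1r subrr addrK.
by split=> //; rewrite -[in LHS]U0 (unitary_fwdK uU).
Qed.

Lemma unitary_maps q r (U : operator R q r) c c' :
  unitary U -> fwd U (ket c) = ket c' -> maps U c c'.
Proof.
by move=> uU Uc; split=> //; rewrite -Uc (unitary_fwdK uU)//; exact: square_summable_ket.
Qed.

Lemma perm_op_maps q r (s s' : config R q r -> config R q r) c :
  cancel s s' -> cancel s' s -> maps (perm_op s s') c (s c).
Proof.
move=> sK s'K; split; apply: funext => d; rewrite /= /ket; congr ((nat_of_bool _)%:R).
  by rewrite (can2_eq s'K sK).
by rewrite (can2_eq sK s'K) sK.
Qed.

Lemma add_op_maps q r (i : 'I_r) (F : config R q r -> R) c :
    (forall x c, F (add_real i x c) = F c) ->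
  maps (add_op i F) c (add_real i (F c) c).
Proof.
move=> Fi; apply: perm_op_maps => -[b x]; rewrite Fi /add_real/=; congr pair;
  by apply/ffunP => j; rewrite !ffunE; case: (j == i); rewrite ?addrK ?subrK.
Qed.

Lemma xor_op_maps q r (i : 'I_q) (F : config R q r -> bool) c :
    (forall b c, F (xor_bit i b c) = F c) ->
  maps (xor_op i F) c (xor_bit i (F c) c).
Proof.
move=> Fi; have K : cancel (fun c => xor_bit i (F c) c) (fun c => xor_bit i (F c) c).
  move=> [b x]; rewrite Fi /xor_bit /set_bit/=; congr pair; apply/ffunP => j.
  by rewrite !ffunE eqxx; case: eqP => // ->; rewrite addbK.
exact: perm_op_maps.
Qed.

Lemma gate_preserves0 (p : R) g : preserves0 (gate_op p g).
Proof.
by case: g; split => //=; apply: funext => c; rewrite /= ?mulr0 ?addr0 ?mulr0.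
Qed.

Lemma read_write a b q r (f : emb a q) (g : emb b r) (l : config R a b) c :
  read f g (write f g l c) = l.
Proof.
case: l => [l1 l2]; congr pair; apply/ffunP => i; rewrite !ffunE.
  by case: pickP => [j /eqP /emb_inj -> //|/(_ i)]; rewrite eqxx.
by case: pickP => [j /eqP /emb_inj -> //|/(_ i)]; rewrite eqxx.
Qed.

Definition agree_off a b q r (f : emb a q) (g : emb b r) (c c' : config R q r) :=
  (forall i, i \notin codom f -> c.1 i = c'.1 i) /\
  (forall i, i \notin codom g -> c.2 i = c'.2 i).

Lemma agree_off_write a b q r (f : emb a q) (g : emb b r) (l : config R a b) c :
  agree_off f g c (write f g l c).
Proof.
split=> i iP; rewrite /= ffunE; case: pickP => // j /eqP ij;
  by rewrite -ij codom_f in iP.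
Qed.

Lemma agree_off_read_inj a b q r (f : emb a q) (g : emb b r) c c' :
  agree_off f g c c' -> read f g c = read f g c' -> c = c'.
Proof.
case: c c' => [c1 c2] [d1 d2] [/= E1 E2] [/ffunP F1 /ffunP F2].
congr pair; apply/ffunP => i.
  have [/codomP[j ->]|] := boolP (i \in codom f); last exact: E1.
  by have := F1 j; rewrite !ffunE.
have [/codomP[j ->]|] := boolP (i \in codom g); last exact: E2.
by have := F2 j; rewrite !ffunE.
Qed.

(** Restricted to the addressed registers, [ket c] is the basis state of [read f g c] if the
    remaining registers agree with [c], and the zero family otherwise. *)
Lemma act_on_ket a b q r (f : emb a q) (g : emb b r)
    (U : state R a b -> state R a b) c c' :
    U (fun=> 0) = (fun=> 0) -> U (ket (read f g c)) = ket (read f g c') ->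
    agree_off f g c c' ->
  act_on f g U (ket c) = ket c'.
Proof.
move=> U0 Uc cc'; apply: funext => d; rewrite /act_on.
have [cd|cd] := pselect (agree_off f g c d).
  rewrite (_ : (fun _ => _) = ket (read f g c)) ?Uc.
    rewrite /ket; congr ((nat_of_bool _)%:R); apply/idP/idP => /eqP E; last by rewrite E.
    apply/eqP; apply: agree_off_read_inj E.
    by case: cc' cd => A1 A2 [B1 B2]; split=> i iP; rewrite -?B1 -?A1 -?B2 -?A2.
  apply: funext => l; rewrite /ket; congr ((nat_of_bool _)%:R); apply/idP/idP => /eqP E.
    by rewrite -E read_write.
  rewrite {}E; apply/eqP; apply: (@agree_off_read_inj _ _ _ _ f g); last by rewrite read_write.
  have [A1 A2] := agree_off_write f g (read f g c) d.
  by case: cd => B1 B2; split=> i iP; rewrite ?B1 ?A1 ?B2 ?A2.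
rewrite (_ : (fun _ => _) = fun=> 0) ?U0.
  rewrite /ket; case: eqP => // E; case: cd.
  by rewrite E.
apply: funext => l; rewrite /ket; case: eqP => // E; case: cd.
have [A1 A2] := agree_off_write f g l d.
by rewrite -E; split=> i iP; rewrite -?A1 -?A2.
Qed.

End Kets.

(* Contents of qubits named by [Q] and real registers named by [X]. Naming
   registers by finite types makes their distinctness a matter of constructors. *)
Notation memory R Q X := ((Q -> bool) * (X -> Real.sort R))%type.

(** * Programs on named registers and their inverses *)

Section Programs.
Context {R : realType}.
Variables (n m k : nat) (Q X : finType).

Record ninstr := NInstr {
  nop : gate + query;
  ninv : bool;
  nqubits : 'I_(op_qubits n m k nop) -> Q;
  nreals : 'I_(op_reals nop) -> X }.

Definition inverse (I : ninstr) :=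
  @NInstr (nop I) (~~ ninv I) (@nqubits I) (@nreals I).

Definition nread a b (f : 'I_a -> Q) (g : 'I_b -> X) (c : memory R Q X) :
  config R a b := ([ffun i => c.1 (f i)], [ffun i => c.2 (g i)]).

(* The adjoint is included to make the relation symmetric under [inverse]. *)
Definition step (p : R) (O : oracles R n m k) (I : ninstr) (c c' : memory R Q X) :=
  [/\ injective (@nqubits I), injective (@nreals I),
      maps (if ninv I then dagger (op_sem p O (nop I)) else op_sem p O (nop I))
        (nread (@nqubits I) (@nreals I) c) (nread (@nqubits I) (@nreals I) c'),
      forall x, x \notin codom (@nqubits I) -> c.1 x = c'.1 x &
      forall x, x \notin codom (@nreals I) -> c.2 x = c'.2 x].

Fixpoint exec p O (P : seq ninstr) (c c' : memory R Q X) : Prop :=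
  if P is g :: P' then exists2 c1, step p O g c c1 & exec p O P' c1 c'
  else c = c'.

Definition undo (P : seq ninstr) := rev (map inverse P).

Lemma step_inverse p O I c c' : step p O I c c' -> step p O (inverse I) c' c.
Proof.
case: I => o [] f g [/= fi gi [U1 U2] c1 c2]; split=> //= x xP;
  by rewrite ?c1 ?c2.
Qed.

Lemma exec_cat p O P1 P2 c1 c2 c3 :
  exec p O P1 c1 c2 -> exec p O P2 c2 c3 -> exec p O (P1 ++ P2) c1 c3.
Proof.
elim: P1 c1 => [|I P1 IH] c1 /=; first by move=> ->.
by move=> [c sc e1] e2; exists c => //; exact: IH e1 e2.
Qed.

Lemma exec1 p O I c c' : step p O I c c' -> exec p O [:: I] c c'.
Proof. by exists c'. Qed.

Lemma exec_undo p O P c c' : exec p O P c c' -> exec p O (undo P) c' c.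
Proof.
elim: P c => [|I P IH] c /=; first by move=> ->.
move=> [c1 sc /IH e]; rewrite /undo /= rev_cons -cats1.
by apply: exec_cat e _; apply: exec1; exact: step_inverse.
Qed.

Lemma size_undo P : size (undo P) = size P.
Proof. by rewrite size_rev size_map. Qed.

(** [st] is an invariant indexed by the processed prefix. Splitting [s] at [x] lets each step use
    what separates [x] from the earlier elements. *)
Lemma exec_flatten p O (T : Type) (F : T -> seq ninstr) (st : seq T -> memory R Q X)
    (s : seq T) :
    (forall s1 x s2, s = s1 ++ x :: s2 -> exec p O (F x) (st s1) (st (rcons s1 x))) ->
  exec p O (flatten (map F s)) (st [::]) (st s).
Proof.
elim/last_ind: s => [//|s x IH] H; rewrite map_rcons -cats1 flatten_cat.
apply: (@exec_cat _ _ _ _ _ (st s)) => //.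
  apply: IH => s1 y s2 E; apply: H (s1) (y) (rcons s2 x) _.
  by rewrite E rcons_cat.
by rewrite /= cats0 -(cats1 s) ; have := H s x [::]; rewrite cats1; apply.
Qed.

End Programs.

(** * Compilation of named-register programs to circuits *)

Section Compile.
Context {R : realType}.
Variables (n m k l : nat) (A X : finType).
Let Q : finType := ('I_l + A)%type.

Definition qaddr (x : Q) : 'I_(l + #|A|) :=
  match x with inl i => lshift _ i | inr a => rshift _ (enum_rank a) end.

Definition qname (i : 'I_(l + #|A|)) : Q :=
  match fintype.split i with inl i => inl i | inr j => inr (enum_val j) end.

(** [None] names the output register, which a circuit keeps at real register 0. *)
Definition xaddr (x : option X) : 'I_(#|X|.+1) :=
  if x is Some y then lift ord0 (enum_rank y) else ord0.

Definition xname (i : 'I_(#|X|.+1)) : option X := omap enum_val (unlift ord0 i).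

Lemma qaddrK : cancel qaddr qname.
Proof.
case=> i; rewrite /qname /qaddr; first by rewrite (unsplitK (inl i)).
by rewrite (unsplitK (inr _)) enum_rankK.
Qed.

Lemma qnameK : cancel qname qaddr.
Proof.
move=> i; rewrite /qname; case: splitP => j ij; apply: val_inj; rewrite /= ?enum_valK /=.
  by rewrite ij.
by rewrite ij.
Qed.

Lemma xaddrK : cancel xaddr xname.
Proof.
by case=> [y|]; rewrite /xname /xaddr ?unlift_none //= liftK /= enum_rankK.
Qed.

Lemma xnameK : cancel xname xaddr.
Proof.
move=> i; rewrite /xname; case: unliftP => [j ->|->] //=.
by rewrite enum_valK.
Qed.

Definition layout (c : memory R Q (option X)) : config R (l + #|A|) #|X|.+1 :=
  ([ffun i => c.1 (qname i)], [ffun i => c.2 (xname i)]).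

(** Distinctness of the registers is tested classically, and an instruction failing the test is
    dropped. Every [step] passes it. *)
Definition compile1 (I : ninstr n m k Q (option X)) :
    option (instr n m k (l + #|A|) #|X|.+1) :=
  match pselect (injective (@nqubits _ _ _ _ _ I)), pselect (injective (@nreals _ _ _ _ _ I)) with
  | left fi, left gi =>
      Some (@Instr _ _ _ _ _ (nop I) (ninv I)
             (Emb (inj_comp (can_inj qaddrK) fi)) (Emb (inj_comp (can_inj xaddrK) gi)))
  | _, _ => None
  end.

Definition compile (P : seq (ninstr n m k Q (option X))) : circuit n m k l :=
  @Circuit _ _ _ _ #|A| #|X| (pmap compile1 P).

Lemma cost_compile P : (cost (compile P) <= size P)%N.
Proof. by rewrite /cost /= size_pmap; apply: count_size. Qed.

Lemma compile1P p O I c c' :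
    (forall x, unitary (O x)) -> step p O I c c' ->
  exists2 J, compile1 I = Some J &
    instr_sem p O J (ket (layout c)) = ket (layout c').
Proof.
move=> uO [fi gi [U1 U2] c1 c2]; rewrite /compile1.
case: pselect => // fi'; case: pselect => // gi'; eexists; first by [].
rewrite /instr_sem /=.
have [z1 z2] : preserves0 (op_sem p O (nop I)).
  case: (nop I) => [g|x]; first exact: gate_preserves0.
  exact: unitary_preserves0 (uO x).
apply: act_on_ket.
- by case: (ninv I).
- rewrite (_ : read _ _ (layout c) = nread (@nqubits _ _ _ _ _ I) (@nreals _ _ _ _ _ I) c).
    rewrite U1; congr ket; congr pair; apply/ffunP => i; rewrite !ffunE /=.
      by rewrite qaddrK.
    by rewrite xaddrK.
  by congr pair; apply/ffunP => i; rewrite !ffunE /= ?qaddrK ?xaddrK.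
- split=> i iP; rewrite !ffunE.
    apply: c1; apply: contra iP => /codomP[j E].
    by rewrite -(qnameK i) E (codom_f (qaddr \o _)).
  apply: c2; apply: contra iP => /codomP[j E].
  by rewrite -(xnameK i) E (codom_f (xaddr \o _)).
Qed.

Lemma compileP p O P c c' :
    (forall x, unitary (O x)) -> exec p O P c c' ->
  run p O (C := compile P) (ket (layout c)) = ket (layout c').
Proof.
move=> uO; rewrite /run /=.
elim: P c => [|I P IH] c /=; first by move=> ->.
by move=> [c1 /(compile1P uO) [J -> E] /IH {}IH] /=; rewrite E.
Qed.

Definition start (s : seq bool) (x : R) : memory R Q (option X) :=
  (fun q : 'I_l + A => if q is inl i then nth false s (nat_of_ord i) else false,
   fun y : option X => if y is Some _ then 0 else x).

Lemma compile_outputs p O P s x :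
    (forall x, unitary (O x)) -> (size s <= l)%N -> exec p O P (start s 0) (start s x) ->
  outputs p O (compile P) s x.
Proof.
move=> uO sl /(compileP uO); rewrite /outputs.
suff E y : layout (start s y) = conf (l + #|A|) #|X|.+1 s [:: y] by rewrite !E.
congr pair; apply/ffunP => i; rewrite !ffunE.
  rewrite /qname; case: splitP => j -> //=.
  by rewrite nth_default// (leq_trans sl)// leq_addr.
rewrite /xname; case: unliftP => [j ->|->] //=.
by rewrite nth_nil.
Qed.

End Compile.

(** * Straight-line programs over real registers *)

Definition upd (T : eqType) (S : Type) (f : T -> S) (z : T) (v : S) : T -> S :=
  fun x => if x == z then v else f x.

(** One constructor per gate on real registers, stripped of the register to which the gate adds. *)
Inductive term (Q Y : Type) :=
  TInc | TBit of Q & Y | TMul of Y & Y | TPow of Y | TRoot of Y.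
Arguments TInc {Q Y}.
Arguments TBit {Q Y}.
Arguments TMul {Q Y}.
Arguments TPow {Q Y}.
Arguments TRoot {Q Y}.

Definition term_args Q Y (t : term Q Y) : seq Y :=
  match t with
  | TInc => [::] | TBit _ x => [:: x] | TMul x y => [:: x; y]
  | TPow x => [:: x] | TRoot x => [:: x]
  end.

Definition term_value (R : realType) (p : R) Q Y (b : Q -> bool) (v : Y -> R)
    (t : term Q Y) : R :=
  match t with
  | TInc => 1 | TBit q x => (b q)%:R * v x | TMul x y => v x * v y
  | TPow x => `|v x| `^ p | TRoot x => `|v x| `^ p^-1
  end.

Section Slp.
Context {R : realType}.
Variables (n m k : nat) (Q Y : finType).
Let X : finType := option Y.

Definition term_instr (neg : bool) (t : term Q Y) (z : X) : ninstr n m k Q X :=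
  match t with
  | TInc => @NInstr n m k Q X (inl GInc) neg (tnth [tuple]) (tnth [tuple z])
  | TBit q x => @NInstr n m k Q X (inl GAdd) neg (tnth [tuple q]) (tnth [tuple Some x; z])
  | TMul x y =>
      @NInstr n m k Q X (inl GMul) neg (tnth [tuple]) (tnth [tuple Some x; Some y; z])
  | TPow x => @NInstr n m k Q X (inl GPow) neg (tnth [tuple]) (tnth [tuple Some x; z])
  | TRoot x => @NInstr n m k Q X (inl GRoot) neg (tnth [tuple]) (tnth [tuple Some x; z])
  end.

Lemma step_add_gate (p : R) (O : oracles R n m k) g
    (qt : (gate_qubits g).-tuple Q) (rt : (gate_reals g).-tuple X)
    i (F : config R _ _ -> R) (c : memory R Q X) :
    gate_op p g = add_op i F -> (forall x c, F (add_real i x c) = F c) ->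
    uniq qt -> uniq rt ->
  step p O (@NInstr n m k Q X (inl g) false (tnth qt) (tnth rt)) c
    (c.1, upd c.2 (tnth rt i) (c.2 (tnth rt i) + F (nread (tnth qt) (tnth rt) c))).
Proof.
move=> gE Fi /tuple_uniqP qi /tuple_uniqP ri; split=> //=; last first.
  by move=> x xP; rewrite /upd; case: eqP => // E; rewrite E codom_f in xP.
rewrite gE; set d := nread _ _ c.
rewrite (_ : nread _ _ _ = add_real i (F d) d); first exact: add_op_maps.
congr pair; apply/ffunP => j; rewrite !ffunE //= /upd (inj_eq ri).
by case: eqP => [->|].
Qed.

Lemma eq_term_value p (b : Q -> bool) (v v' : Y -> R) (t : term Q Y) :
  {in term_args t, v =1 v'} -> term_value p b v t = term_value p b v' t.
Proof.
by case: t => [|q x|x y|x|x] vv' //=; rewrite ?vv' ?inE ?eqxx ?orbT.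
Qed.

Lemma step_term_instr (p : R) (O : oracles R n m k) neg t z (c : memory R Q X) :
    uniq (rcons (map Some (term_args t)) z) ->
  step p O (term_instr neg t z) c
    (c.1, upd c.2 z (c.2 z + (-1) ^+ neg * term_value p c.1 (c.2 \o Some) t)).
Proof.
move=> ut.
have pos c' : step p O (term_instr false t z) c'
    (c'.1, upd c'.2 z (c'.2 z + term_value p c'.1 (c'.2 \o Some) t)).
  case: t ut => [|q x|x y|x|x] /= ut.
  - have := @step_add_gate p O GInc [tuple] [tuple z] (inord 0) _ c' erefl.
    by rewrite (tnth_nth z) /= inordK //; apply.
  - have := @step_add_gate p O GAdd [tuple q] [tuple Some x; z] (inord 1) _ c' erefl.
    rewrite !(tnth_nth z) /= inordK //= !ffunE !(tnth_nth z) !(tnth_nth q) !inordK //=.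
    by apply => // r' c''; rewrite !ffunE -val_eqE /= !inordK.
  - have := @step_add_gate p O GMul [tuple] [tuple Some x; Some y; z] (inord 2) _ c' erefl.
    rewrite !(tnth_nth z) /= inordK //= !ffunE !(tnth_nth z) !inordK //=.
    by apply => // r' c''; rewrite !ffunE -!val_eqE /= !inordK.
  - have := @step_add_gate p O GPow [tuple] [tuple Some x; z] (inord 1) _ c' erefl.
    rewrite !(tnth_nth z) /= inordK //= !ffunE !(tnth_nth z) !inordK //=.
    by apply => // r' c''; rewrite !ffunE -!val_eqE /= !inordK.
  - have := @step_add_gate p O GRoot [tuple] [tuple Some x; z] (inord 1) _ c' erefl.
    rewrite !(tnth_nth z) /= inordK //= !ffunE !(tnth_nth z) !inordK //=.
    by apply => // r' c''; rewrite !ffunE -!val_eqE /= !inordK.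
case: neg; last by rewrite mul1r; exact: pos.
rewrite mulN1r.
(* Subtraction is the inverse of the addition that starts at the subtracted memory [c']. The term
   has the same value there because [z] is not among its arguments. *)
set c' := (c.1, _).
have := pos c'.
rewrite (_ : term_value p c'.1 _ t = term_value p c.1 (c.2 \o Some) t); last first.
  apply: eq_term_value => x xt; rewrite /= /upd; case: eqP => // E.
  by move: ut; rewrite rcons_uniq -E map_f.
rewrite [X in (_, X)](_ : _ = c.2); last first.
  by apply: funext => x; rewrite /= /upd eqxx subrK; case: eqP => [->|].
have -> : (c'.1, c.2) = c by rewrite /c' /=; case: (c).
by move=> /step_inverse; case: t {ut pos} @c'.
Qed.

Definition term_prog (z : X) (ts : seq (bool * term Q Y)) : seq (ninstr n m k Q X) :=
  [seq term_instr bt.1 bt.2 z | bt <- ts].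

Definition term_sum (p : R) (b : Q -> bool) (v : Y -> R) (ts : seq (bool * term Q Y)) : R :=
  \sum_(bt <- ts) (-1) ^+ bt.1 * term_value p b v bt.2.

Lemma exec_term_prog (p : R) O z ts (c : memory R Q X) :
    all (fun bt => uniq (rcons (map Some (term_args bt.2)) z)) ts ->
  exec p O (term_prog z ts) c (c.1, upd c.2 z (c.2 z + term_sum p c.1 (c.2 \o Some) ts)).
Proof.
rewrite /term_sum; elim: ts c => [|bt ts IH] c /= => [_|/andP[ubt uts]].
  rewrite big_nil addr0; case: c => c1 c2; congr pair.
  by apply: funext => x; rewrite /upd; case: eqP => [->|].
eexists; first exact: step_term_instr.
set c' := (c.1, _).
have := IH c' uts.
rewrite [X in (_, X)](_ : _ = upd c.2 z (c.2 z +
   \sum_(bt0 <- (bt :: ts)) (-1) ^+ bt0.1 * term_value p c.1 (c.2 \o Some) bt0.2)) //.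
apply: funext => x; rewrite [LHS]/upd [RHS]/upd; case: eqP => [_|/eqP/negPf xz]; last first.
  by rewrite /= /upd xz.
have -> : c'.2 z = c.2 z + (-1) ^+ bt.1 * term_value p c.1 (c.2 \o Some) bt.2.
  by rewrite /c' /= /upd eqxx.
rewrite big_cons addrA; congr (_ + _).
(* The remaining terms keep their values when [z] changes, as none of them has [z] as an
   argument. *)
elim: ts uts {IH ubt} => [|a ts IH] /= => [_|/andP[ua uts]]; first by rewrite !big_nil.
rewrite !big_cons IH//.
congr (_ * _ + _); apply: eq_term_value => y ya /=; rewrite /upd; case: eqP => // E.
by move: ua; rewrite rcons_uniq -E map_f.
Qed.

Lemma term_sum_nil (p : R) (b : Q -> bool) (v : Y -> R) : term_sum p b v [::] = 0.
Proof. exact: big_nil. Qed.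

Lemma term_sum_cons (p : R) (b : Q -> bool) (v : Y -> R) neg (t : term Q Y) ts :
  term_sum p b v ((neg, t) :: ts) = (-1) ^+ neg * term_value p b v t + term_sum p b v ts.
Proof. exact: big_cons. Qed.

Lemma term_sum_cat (p : R) (b : Q -> bool) (v : Y -> R) ts1 ts2 :
  term_sum p b v (ts1 ++ ts2) = term_sum p b v ts1 + term_sum p b v ts2.
Proof. exact: big_cat. Qed.

Lemma term_sum_nseq (p : R) (b : Q -> bool) (v : Y -> R) q neg (t : term Q Y) :
  term_sum p b v (nseq q (neg, t)) = (-1) ^+ neg * term_value p b v t *+ q.
Proof. by rewrite /term_sum big_nseq iter_addr_0. Qed.

Lemma term_sum_map (p : R) (b : Q -> bool) (v : Y -> R) (T : finType) (F : T -> term Q Y) :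
  term_sum p b v [seq (false, F x) | x <- enum T] = \sum_x term_value p b v (F x).
Proof. by rewrite /term_sum big_map big_enum; apply: eq_bigr => x _; rewrite mul1r. Qed.

Definition term_sumE := (term_sum_cat, term_sum_nseq, term_sum_map, term_sum_cons, term_sum_nil).

Variables (terms : Y -> seq (bool * term Q Y)) (rk : Y -> nat).

(* Each register [z] receives the signed sum of [terms z], which only mentions
   registers of smaller rank. *)
Definition slp : seq (ninstr n m k Q X) :=
  flatten [seq term_prog (Some z) (terms z) | z <- sort (relpre rk leq) (enum Y)].

(** The registers of a gate must differ, hence [uniq]; in particular [TMul x x] is excluded. *)
Definition slp_wf := forall z, all (fun bt => uniq (term_args bt.2) &&
  all (fun x => rk x < rk z)%N (term_args bt.2)) (terms z).

Definition regs (o : R) (v : Y -> R) : X -> R := fun y => if y is Some z then v z else o.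

(** Any solution [v] of the equations is the final content. In order of rank, the arguments of
    [terms z] are finished before [z] is processed, so each prefix of the program leaves [v] on the
    processed registers and [v0] on the others. *)
Lemma exec_slp (p : R) O (b : Q -> bool) (o : R) (v0 v : Y -> R) :
    slp_wf -> (forall z, v z = v0 z + term_sum p b v (terms z)) ->
  exec p O slp (b, regs o v0) (b, regs o v).
Proof.
move=> wf vE; rewrite /slp; set s := sort _ _.
have sY z : z \in s by rewrite mem_sort mem_enum.
have us : uniq s by rewrite sort_uniq enum_uniq.
have ss : pairwise (relpre rk leq) s.
  rewrite -sorted_pairwise; first by apply: sort_sorted => x y; exact: leq_total.
  by move=> x y z; exact: leq_trans.
have -> : (b, regs o v0) = (b, regs o (fun z => if z \in [::] then v z else v0 z)) by [].
have -> : (b, regs o v) = (b, regs o (fun z => if z \in s then v z else v0 z)).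
  by congr (_, regs _ _); apply: funext => z; rewrite sY.
apply: (@exec_flatten _ _ _ _ _ _ p O _ _
  (fun s => (b, regs o (fun z => if z \in s then v z else v0 z)))) => s1 z s2 sE.
have zs1 : z \notin s1.
  by move: us; rewrite sE cat_uniq /= negb_or => /and3P[_ /andP[]].
have lt_s1 x : (rk x < rk z)%N -> x \in s1.
  move=> xz; have := sY x; rewrite sE mem_cat in_cons => /or3P[//|/eqP xE|xs2].
    by rewrite xE ltnn in xz.
  move: ss; rewrite sE pairwise_cat /= => /and4P[_ _ /allP/(_ _ xs2) /=].
  by rewrite leqNgt xz.
set w := fun z => if z \in s1 then v z else v0 z.
rewrite [X in exec _ _ _ _ (_, X)](_ : _ =
    upd (regs o w) (Some z) (regs o w (Some z) + term_sum p b w (terms z))).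
  apply: (@exec_term_prog p O (Some z) (terms z) (b, regs o w)).
  apply: sub_all (wf z) => bt /andP[ubt /allP rbt].
  rewrite rcons_uniq map_inj_uniq ?ubt ?andbT; last by move=> ? ? [].
  by rewrite mem_map; [apply/negP => /rbt; rewrite ltnn|move=> ? ? []].
apply: funext => -[y|//]; rewrite /upd /= (inj_eq (@Some_inj _)) mem_rcons in_cons.
case: eqP => [->|//] /=; rewrite /w (negPf zs1) vE; congr (_ + _); rewrite /term_sum.
have := wf z; elim: (terms z) => [|a ts IH] /= => [_|/andP[/andP[_ /allP ra] wfz]].
  by rewrite !big_nil.
rewrite !big_cons IH//; congr (_ * _ + _); apply: eq_term_value => x xa /=.
by rewrite lt_s1// ra.
Qed.

Lemma size_flatten_map (T S : Type) (F : T -> seq S) s :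
  size (flatten (map F s)) = (\sum_(x <- s) size (F x))%N.
Proof. by elim: s => [|x s IH]; rewrite ?big_nil// big_cons /= size_cat IH. Qed.

Lemma size_slp : size slp = (\sum_(z : Y) size (terms z))%N.
Proof.
rewrite /slp size_flatten_map -big_enum /=.
rewrite (perm_big (enum Y)) ?perm_sort//.
by apply: eq_bigr => z _; rewrite size_map.
Qed.

End Slp.

(** * Computing, copying the result, and uncomputing *)

Section SlpCircuit.
Context {R : realType}.
Variables (n m k l : nat) (A Y : finType).
Let Q : finType := ('I_l + A)%type.
Variables (pre : seq (ninstr n m k Q (option Y))).
Variables (terms : Y -> seq (bool * term Q Y)) (rk : Y -> nat) (one res : Y).

(** The copy is a product with the register [one], which holds 1: [GAdd] would need a control
    qubit. *)
Definition slp_circuit : circuit n m k l :=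
  let P := pre ++ slp n m k terms rk in
  compile (P ++ term_instr n m k false (TMul res one) None :: undo P).

Lemma cost_slp_circuit :
  (cost slp_circuit <= 2 * (size pre + \sum_(z : Y) size (terms z)) + 1)%N.
Proof.
apply: leq_trans (cost_compile _) _; rewrite size_cat /= size_undo size_cat size_slp.
by rewrite addnS addn1 mul2n addnn.
Qed.

Lemma slp_circuit_outputs (p : R) O s b v0 v :
    (forall x, unitary (O x)) -> (size s <= l)%N ->
    (forall o, exec p O pre (start l A Y s o) (b, regs o v0)) ->
    slp_wf terms rk -> (forall z, v z = v0 z + term_sum p b v (terms z)) ->
    v one = 1 -> res != one ->
  outputs p O slp_circuit s (v res).
Proof.
move=> uO sl epre wf vE v1 ro; apply: compile_outputs => //.
set P := pre ++ _.
(* The forward program does the same for every content [o] of the output register, so it can be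
   undone after the result has been written there. *)
have eP o : exec p O P (start l A Y s o) (b, regs o v).
  by apply: exec_cat (epre o) _; exact: exec_slp.
apply: (exec_cat (eP 0)); rewrite -cat1s; apply: exec_cat (exec_undo (eP (v res))).
apply: exec1.
rewrite [X in step _ _ _ _ (_, X)](_ : _ =
    upd (regs 0 v) None (regs 0 v None + (-1) ^+ false * term_value p b v (TMul res one))).
  apply: (@step_term_instr R n m k Q Y p O false (TMul res one) None (b, regs 0 v));
  by rewrite /= andbT !inE orbF.
by apply: funext => -[y|] //; rewrite /upd /= v1 mulr1 mul1r add0r.
Qed.

End SlpCircuit.

(** * The lattice of a CNF formula *)

Section LatticeInstance.
Context {R : realType}.
Variables (n m k : nat) (p : R).
Hypothesis p1 : 1 <= p.
Variables (V : 'M[R]_(2 ^ k, k)) (u : 'cV[R]_(2 ^ k)) (psi : cnf n m).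
Let N := (m * 2 ^ k + n)%N.

Definition rank (w : 'I_m) (j : nat) : nat :=
  (\sum_(j' < n | (j' < j)%N) (psi w j' != None))%N.

Lemma two_expn_gt0 : (0 < 2 ^ k)%N. Proof. by rewrite expn_gt0. Qed.

Definition low (h : nat) : 'I_(2 ^ k) := Ordinal (ltn_pmod h two_expn_gt0).

(** The entry of $V$ in the column given by the slot of $x_j$. As a sum of indicators it is 0 for
    ranks outside the columns of $V$, which variables absent from the clause may have. *)
Definition coef (i : 'I_(2 ^ k)) (w : 'I_m) (j : 'I_n) : R :=
  \sum_(s < k) (rank w j == s)%:R * V i s.

Definition pos (o : option bool) : R := (o == Some true)%:R.
Definition neg (o : option bool) : R := (o == Some false)%:R.

Definition margin : R := m.+1%:R.

(** Rows are selected by sums of indicators because the circuit evaluates the entry in this form. *)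
Definition cnf_basis : 'M[R]_(N, n) := \matrix_(h, j)
  (\sum_(w < m) (h %/ 2 ^ k == w)%N%:R *
       ((pos (psi w j) - neg (psi w j)) * coef (low h) w j) +
   (h == m * 2 ^ k + j :> nat)%N%:R * (2 * margin)).

Definition cnf_target : 'cV[R]_N := \col_h
  (\sum_(w < m) (h %/ 2 ^ k == w)%N%:R *
      (u (low h) 0 - \sum_j neg (psi w j) * coef (low h) w j) +
   \sum_(j < n) (h == m * 2 ^ k + j :> nat)%N%:R * margin).

Definition ball_radius_pow : R := m%:R + n%:R * margin `^ p.
Definition ball_radius : R := ball_radius_pow `^ p^-1.

Lemma clause_row_lt (w : 'I_m) (i : 'I_(2 ^ k)) : (w * 2 ^ k + i < m * 2 ^ k)%N.
Proof.
apply: (@leq_trans (w.+1 * 2 ^ k)); first by rewrite mulSn addnC ltn_add2r.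
by rewrite leq_mul2r ltn_ord orbT.
Qed.

Definition clause_row w i : 'I_N := lshift n (Ordinal (clause_row_lt w i)).

Lemma clause_row_div w i : (clause_row w i %/ 2 ^ k)%N = w.
Proof. by rewrite /= divnMDl ?two_expn_gt0// divn_small ?addn0. Qed.

Lemma low_clause_row w i : low (clause_row w i) = i.
Proof. by apply: val_inj; rewrite /= modnMDl modn_small. Qed.

Lemma sum_rows (F : 'I_N -> R) :
  \sum_h F h = \sum_w \sum_i F (clause_row w i) + \sum_j F (rshift _ j).
Proof.
rewrite big_split_ord; congr (_ + _); rewrite pair_big /=.
rewrite (reindex (fun wi : 'I_m * 'I_(2 ^ k) => Ordinal (clause_row_lt wi.1 wi.2))) //=.
have dP (a : 'I_(m * 2 ^ k)) : (a %/ 2 ^ k < m)%N by rewrite ltn_divLR ?two_expn_gt0.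
exists (fun a => (Ordinal (dP a), low a)) => [[w i] _|a _].
  congr pair; apply: val_inj; rewrite /= ?modnMDl ?modn_small//.
  by rewrite divnMDl ?two_expn_gt0// divn_small ?addn0.
by apply: val_inj => /=; rewrite -divn_eq.
Qed.

Lemma sum_eq_clause (w : 'I_m) (F : 'I_m -> R) :
  \sum_(w' < m) ((w == w' :> nat)%:R * F w') = F w.
Proof.
rewrite (bigD1 w)//= eqxx mul1r big1 ?addr0// => w' /negPf.
by rewrite -val_eqE eq_sym /= => ->; rewrite mul0r.
Qed.

Lemma cnf_basis_clause_row w i j :
  cnf_basis (clause_row w i) j = (pos (psi w j) - neg (psi w j)) * coef i w j.
Proof.
rewrite mxE low_clause_row clause_row_div sum_eq_clause ltn_eqF ?mul0r ?addr0//=.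
exact: leq_trans (clause_row_lt w i) (leq_addr _ _).
Qed.

Lemma cnf_target_clause_row w i :
  cnf_target (clause_row w i) 0 = u i 0 - \sum_j neg (psi w j) * coef i w j.
Proof.
rewrite mxE low_clause_row clause_row_div sum_eq_clause [X in _ + X]big1 ?addr0// => j _.
rewrite ltn_eqF ?mul0r//=.
exact: leq_trans (clause_row_lt w i) (leq_addr _ _).
Qed.

Lemma box_row_div (j : 'I_n) (w : 'I_m) : ((m * 2 ^ k + j) %/ 2 ^ k == w)%N = false.
Proof.
apply/negbTE; rewrite neq_ltn; apply/orP; right.
apply: leq_trans (ltn_ord w) _; rewrite leq_divRL ?two_expn_gt0//.
exact: leq_addr.
Qed.

Lemma cnf_basis_box_row j j' : cnf_basis (rshift _ j) j' = (j == j')%:R * (2 * margin).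
Proof.
rewrite mxE big1 ?add0r => [|w _]; first by rewrite /= eqn_add2l.
by rewrite box_row_div mul0r.
Qed.

Lemma cnf_target_box_row j : cnf_target (rshift _ j) 0 = margin.
Proof.
rewrite mxE big1 ?add0r => [|w _]; last by rewrite box_row_div mul0r.
rewrite (bigD1 j)//= eqxx mul1r big1 ?addr0// => j' /negPf jj'.
by rewrite eqn_add2l eq_sym [(j' == j :> nat)]jj' mul0r.
Qed.

Lemma margin_gt0 : 0 < margin. Proof. by rewrite ltr0n. Qed.

Lemma is_basis_cnf_basis : is_basis cnf_basis.
Proof.
(* This right inverse of $B^T$ is supported on the last $n$ rows, where $B$ is $2(m+1)$ times the
   identity. *)
apply/row_freeP; exists (\matrix_(h, j) ((h == m * 2 ^ k + j :> nat)%N%:R / (2 * margin))).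
apply/matrixP => j j'; rewrite !mxE sum_rows.
rewrite big1 ?add0r => [|w _]; last first.
  rewrite big1// => i _; rewrite [X in _ * X]mxE ltn_eqF ?mul0r ?mulr0//=.
  exact: leq_trans (clause_row_lt w i) (leq_addr _ _).
have h0 : 2 * margin != 0 by rewrite mulf_neq0 ?gt_eqF ?margin_gt0// ltr0n.
rewrite (bigD1 j)//= big1 ?addr0 => [|i /negPf ij].
  by rewrite [cnf_basis^T _ _]mxE cnf_basis_box_row eqxx mul1r mxE /= eqn_add2l mulrC divfK.
by rewrite [cnf_basis^T _ _]mxE cnf_basis_box_row ij !mul0r.
Qed.

(** Moving the negative-literal terms of the target into the sum gives each variable the factor
    $z_j$ for a positive literal, $1-z_j$ for a negative one and 0 if absent. *)
Lemma row_product (z : 'I_n -> R) w i :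
  \sum_j cnf_basis (clause_row w i) j * z j - cnf_target (clause_row w i) 0 =
  \sum_j coef i w j * ((pos (psi w j) - neg (psi w j)) * z j + neg (psi w j)) - u i 0.
Proof.
rewrite cnf_target_clause_row opprB addrA; congr (_ - _); rewrite -big_split /=.
by apply: eq_bigr => j _; rewrite cnf_basis_clause_row; ring.
Qed.

Lemma literalE (o : option bool) (b : bool) :
  (pos o - neg o) * b%:R + neg o = (o == Some b)%:R :> R.
Proof. by case: o b => [[]|] []; rewrite /pos /neg /=; ring. Qed.

(** * Slots of the literals of a clause *)

Hypothesis psik : is_kcnf k psi.

(** The variable [j] is one of the at most $k$ occurring ones but is not counted in its own rank. *)
Lemma rank_lt w (j : 'I_n) : psi w j != None -> (rank w j < k)%N.
Proof.
move=> wj; apply: leq_trans (psik w); rewrite /rank -sum1_card.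
rewrite [X in (_ < X)%N](bigD1 j) ?inE//= add1n ltnS.
rewrite [X in (X <= _)%N]big_mkcond [X in (_ <= X)%N]big_mkcond; apply: leq_sum => i _.
rewrite inE; case: ifP => // ij; case: (psi w i != None) => //=.
by rewrite -val_eqE /= (ltn_eqF ij).
Qed.

Lemma rankS w (j : 'I_n) : rank w j.+1 = (rank w j + (psi w j != None))%N.
Proof.
rewrite /rank big_mkcond (bigD1 j)//= ltnSn addnC; congr (_ + _)%N.
rewrite [RHS]big_mkcond [RHS](bigD1 j)//= ltnn add0n; apply: eq_bigr => i ij.
by rewrite ltnS leq_eqVlt -[(i == j :> nat)]/(i == j) (negPf ij).
Qed.

Lemma rank_mono w j j' : (j <= j')%N -> (rank w j <= rank w j')%N.
Proof.
move=> jj'; rewrite /rank big_mkcond [X in (_ <= X)%N]big_mkcond; apply: leq_sum => i _.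
by case: ifP => // ij; rewrite (leq_trans ij).
Qed.

(** The rank never decreases and grows by one just past an occurring variable. *)
Lemma rank_inj w (j j' : 'I_n) :
  psi w j != None -> psi w j' != None -> rank w j = rank w j' -> j = j'.
Proof.
wlog jj' : j j' / (j <= j')%N => [H wj wj' E|wj _ E].
  by case/orP: (leq_total j j') => jj'; [|symmetry]; apply: H.
apply: val_inj; apply/eqP; rewrite eqn_leq jj' leqNgt /=; apply/negP => jlt.
by have := rank_mono w jlt; rewrite rankS wj addn1 E ltnn.
Qed.

(* The truth values under [x] of the literals of clause [w], by slot. *)
Definition slots w (x : {ffun 'I_n -> bool}) : {ffun 'I_k -> bool} :=
  [ffun s : 'I_k => [exists j : 'I_n, (rank w j == s) && (psi w j == Some (x j))]].

(** By [rank_inj] at most one literal occupies slot [s], so the sum has at most one nonzero term. *)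
Lemma slotsE w (x : {ffun 'I_n -> bool}) (s : 'I_k) :
  \sum_(j < n) (rank w j == s)%:R * (psi w j == Some (x j))%:R = (slots w x s)%:R :> R.
Proof.
rewrite ffunE; case: existsP => [[j /andP[/eqP js /eqP jx]]|H]; last first.
  rewrite big1// => j _; case: eqP => js; case: eqP => jx; rewrite ?mulr0 ?mul0r//.
  by case: H; exists j; rewrite js jx !eqxx.
rewrite (bigD1 j)//= js jx !eqxx mul1r big1 ?addr0// => j' /eqP jj'.
case: eqP => js'; case: eqP => jx'; rewrite ?mulr0 ?mul0r//.
by case: jj'; apply: (@rank_inj w); rewrite ?js ?js' ?jx ?jx'.
Qed.

Lemma slots_sat w (x : {ffun 'I_n -> bool}) :
  (exists s, slots w x s) <-> [exists j, psi w j == Some (x j)].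
Proof.
split=> [[s]|/existsP[j jx]].
  by rewrite ffunE => /existsP[j /andP[_ jx]]; apply/existsP; exists j.
have wj : psi w j != None by rewrite (eqP jx).
by exists (Ordinal (rank_lt wj)); rewrite ffunE; apply/existsP; exists j; rewrite eqxx jx.
Qed.

Lemma row_product_bool (x : {ffun 'I_n -> bool}) w i :
  \sum_j cnf_basis (clause_row w i) j * (x j)%:R - cnf_target (clause_row w i) 0 =
  (V *m \col_s (slots w x s)%:R - u) i 0.
Proof.
rewrite row_product !mxE; congr (_ - _).
under eq_bigr => j _ do rewrite literalE /coef mulr_suml.
rewrite exchange_big /=; apply: eq_bigr => s _; rewrite mxE -slotsE mulr_sumr.
by apply: eq_bigr => j _; ring.
Qed.

(** * Lattice points in the ball *)

Definition psum d (v : 'cV[R]_d) : R := \sum_(i < d) `|v i 0| `^ p.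

Lemma p_gt0 : 0 < p. Proof. exact: lt_le_trans p1. Qed.

Lemma psum_ge0 d (v : 'cV[R]_d) : 0 <= psum v.
Proof. by apply: sumr_ge0 => i _; exact: powR_ge0. Qed.

Lemma powRVK (a : R) : 0 <= a -> (a `^ p^-1) `^ p = a.
Proof. by move=> a0; rewrite -powRrM mulVf ?gt_eqF ?p_gt0// powRr1. Qed.

Lemma lp_norm_powR d (v : 'cV[R]_d) : lp_norm p v `^ p = psum v.
Proof. by rewrite powRVK// psum_ge0. Qed.

Lemma ball_radius_pow_gt0 : (0 < n)%N -> 0 < ball_radius_pow.
Proof.
move=> n0; apply: ltr_wpDl; first exact: ler0n.
by rewrite mulr_gt0 ?ltr0n// powR_gt0// margin_gt0.
Qed.

Lemma lp_norm_le_ball_radius d (v : 'cV[R]_d) :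
  (lp_norm p v <= ball_radius) = (psum v <= ball_radius_pow).
Proof.
have r0 : 0 <= ball_radius_pow by rewrite addr_ge0 ?mulr_ge0 ?ler0n ?powR_ge0.
apply/idP/idP => h; last first.
  by apply: ge0_ler_powR; rewrite ?invr_ge0 ?nnegrE ?psum_ge0 // ltW ?p_gt0.
rewrite -lp_norm_powR -[leRHS]powRVK//.
by apply: ge0_ler_powR; rewrite ?nnegrE ?powR_ge0 // ltW ?p_gt0.
Qed.

Definition lattice_point (z : 'I_n -> R) : 'cV[R]_N :=
  cnf_basis *m (\col_j z j) - cnf_target.

Lemma lattice_pointE z h :
  lattice_point z h 0 = \sum_j cnf_basis h j * z j - cnf_target h 0.
Proof. by rewrite !mxE; congr (_ - _); apply: eq_bigr => j _; rewrite !mxE. Qed.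

Lemma psum_lattice_point z : psum (lattice_point z) =
  \sum_w \sum_i `|lattice_point z (clause_row w i) 0| `^ p +
  \sum_(j < n) (margin * `|2 * z j - 1|) `^ p.
Proof.
rewrite /psum sum_rows; congr (_ + _); apply: eq_bigr => j _; congr (_ `^ _).
rewrite lattice_pointE cnf_target_box_row (bigD1 j)//= big1 ?addr0 => [|i /negPf ji].
  rewrite cnf_basis_box_row eqxx mul1r -[in RHS](gtr0_norm margin_gt0) -normrM.
  by congr `|_|; ring.
by rewrite cnf_basis_box_row eq_sym ji !mul0r.
Qed.

Hypothesis Vu : isolating p V u.

Lemma clause_block (x : {ffun 'I_n -> bool}) w :
  let S := \sum_i `|lattice_point (fun j => (x j)%:R) (clause_row w i) 0| `^ p in
  if [exists j, psi w j == Some (x j)] then S = 1 else 1 < S.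
Proof.
move: Vu => [u1 Vu1] /=.
have -> : \sum_i `|lattice_point (fun j => (x j)%:R) (clause_row w i) 0| `^ p =
    psum (V *m \col_s (slots w x s)%:R - u).
  by apply: eq_bigr => i _; rewrite lattice_pointE row_product_bool.
rewrite -lp_norm_powR; case: ifPn => [/slots_sat/Vu1 ->|sat]; first by rewrite powR1.
(* In an unsatisfied clause all slots are 0, so only $-u$ remains. *)
rewrite (_ : _ - u = - u); last first.
  apply/matrixP => i j; rewrite !mxE big1 ?add0r// => s _; rewrite !mxE.
  case sx : (slots w x s); last by rewrite mulr0.
  by case/negP: sat; apply/slots_sat; exists s.
have -> : lp_norm p (- u) = lp_norm p u.
  by congr (_ `^ _); apply: eq_bigr => i _; rewrite mxE normrN.
rewrite [ltLHS](_ : 1 = 1 `^ p); last by rewrite powR1.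
apply: gt0_ltr_powR; rewrite ?nnegrE ?p_gt0//.
exact: powR_ge0.
Qed.

Lemma bool_box_sum (x : {ffun 'I_n -> bool}) :
  \sum_(j < n) (margin * `|2 * (x j)%:R - 1|) `^ p = n%:R * margin `^ p.
Proof.
rewrite (eq_bigr (fun=> margin `^ p)) ?sumr_const ?card_ord ?mulr_natl// => j _.
case: (x j); first by rewrite mulr1 [2 - 1](_ : _ = 1) ?normr1 ?mulr1//; ring.
by rewrite mulr0 sub0r normrN1 mulr1.
Qed.

(** On 0/1 vectors the last $n$ rows use exactly $n(m+1)^p$. This leaves $m$ for $m$ clause blocks
    of at least 1 each, so no block may exceed 1. *)
Lemma bool_in_ball (x : {ffun 'I_n -> bool}) :
  (psum (lattice_point (fun j => (x j)%:R)) <= ball_radius_pow) = (x \in sol psi).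
Proof.
rewrite psum_lattice_point bool_box_sum lerD2r inE.
have S1 w : 1 <= \sum_i `|lattice_point (fun j => (x j)%:R) (clause_row w i) 0| `^ p.
  by have := clause_block x w => /=; case: ifP => _; [move=> ->|exact: ltW].
have -> : m%:R = \sum_(w < m) 1 :> R by rewrite sumr_const card_ord.
apply/idP/forallP => [h w|sat]; last first.
  by rewrite le_eqVlt (eq_bigr (fun=> 1)) ?eqxx// => w _; have := clause_block x w; rewrite /= sat.
apply: contraLR h => sat; rewrite -ltNge (bigD1 w)//= [ltRHS](bigD1 w)//=.
apply: ltr_leD; last exact: ler_sum.
by have := clause_block x w; rewrite /= (negPf sat).
Qed.

(** $2z-1$ is an odd integer, equal to $\pm1$ only for $z\in\{0,1\}$. *)
Lemma odd_norm (z : int) : (1 <= `|2 * z%:~R - 1| :> R) &&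
  ((z \in [:: 0; 1]) || (3 <= `|2 * z%:~R - 1| :> R)).
Proof.
have -> : (2 * z%:~R - 1 : R) = (2 * z - 1)%:~R by rewrite intrD intrM mulrNz.
rewrite -intr_norm -[1 : R]/(1%:~R) -[3 : R]/(3%:~R) !ler_int !inE.
by apply/andP; split; lia.
Qed.

(** Each of the last $n$ rows contributes at least $(m+1)^p$, and one with $z_j\notin\{0,1\}$ at
    least $3^p(m+1)^p\ge 3(m+1)^p$. The excess $2(m+1)^p$ is larger than $m$ because $p\ge1$. *)
Lemma in_ball_bool (z : 'I_n -> int) :
  psum (lattice_point (fun j => (z j)%:~R)) <= ball_radius_pow ->
  forall j, z j \in [:: 0; 1].
Proof.
move=> h j; apply: contraLR h => zj; rewrite -ltNge psum_lattice_point.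
apply: ltr_wpDl.
  by apply: sumr_ge0 => w _; apply: sumr_ge0 => i _; exact: powR_ge0.
have p0 := p_gt0; have h0 := margin_gt0.
have hp i : margin `^ p <= (margin * `|2 * (z i)%:~R - 1|) `^ p.
  have /andP[z1 _] := odd_norm (z i).
  by apply: ge0_ler_powR; rewrite ?nnegrE ?mulr_ge0 ?ler_peMr// ltW.
have hj : 3 * margin `^ p <= (margin * `|2 * (z j)%:~R - 1|) `^ p.
  have /andP[_] := odd_norm (z j); rewrite (negPf zj) /= => z3.
  rewrite powRM ?(ltW h0)// [leLHS]mulrC ler_pM2l ?powR_gt0//.
  apply: (@le_trans _ _ (3 `^ p)); first by apply: le1r_powR => //; rewrite ler1n.
  by apply: ge0_ler_powR; rewrite ?nnegrE// ltW.
have mp : m%:R < margin `^ p.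
  by apply: (@lt_le_trans _ _ margin); [rewrite ltr_nat|apply: le1r_powR; rewrite ?ler1n].
have -> : ball_radius_pow = m%:R + \sum_(i < n) margin `^ p.
  by rewrite sumr_const card_ord /ball_radius_pow mulr_natl.
rewrite (bigD1 j)//= [ltRHS](bigD1 j)//= addrA; apply: ltr_leD; last exact: ler_sum.
by apply: lt_le_trans hj; have := powR_ge0 margin p; lra.
Qed.

(** The last $n$ rows are multiples of the coordinates of $z$ up to the target. *)
Lemma lattice_point_inj z z' : lattice_point z = lattice_point z' -> z =1 z'.
Proof.
move=> /(addIr _) E j.
have h0 : 2 * margin != 0 by rewrite mulf_neq0 ?gt_eqF ?margin_gt0// ltr0n.
have Ez (y : 'I_n -> R) : (cnf_basis *m (\col_j y j)) (rshift _ j) 0 = y j * (2 * margin).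
  rewrite mxE (bigD1 j)//= big1 ?addr0 => [|i /negPf ji]; rewrite cnf_basis_box_row !mxE.
    by rewrite eqxx mul1r mulrC.
  by rewrite eq_sym ji !mul0r.
by apply: (mulIf h0); rewrite -!Ez E.
Qed.

Lemma card_sol_VCP : (#|sol psi|%:R)%:E = VCP p cnf_basis cnf_target ball_radius.
Proof.
rewrite /VCP; set S := [set v | _]%classic.
pose f (x : {ffun 'I_n -> bool}) := lattice_point (fun j => (x j)%:R).
have f_inj : injective f.
  move=> x y /lattice_point_inj E; apply/ffunP => j; have /eqP := E j.
  by rewrite eqr_nat; case: (x j) (y j) => -[].
(* [in_ball_bool] makes the coefficients of a point in the ball 0/1, and [bool_in_ball] then decides
   satisfaction. An explicit finite set lets [counting] be evaluated. *)
have SE : S = [set` [fset x in map f (enum (sol psi))]%fset]%classic.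
  apply/seteqP; split=> [v [[z zE] vr]|v] /=; rewrite in_fset /=.
    have vE : v = lattice_point (fun j => (z j 0)%:~R).
      by rewrite -[LHS](addrK cnf_target) zE; congr (_ *m _ - _); apply/matrixP => i j; rewrite !mxE ord1.
    have psv : psum (lattice_point (fun j => (z j 0)%:~R)) <= ball_radius_pow.
      by rewrite -vE -lp_norm_le_ball_radius.
    have zb := in_ball_bool psv.
    pose x : {ffun 'I_n -> bool} := [ffun j => z j 0 == 1].
    have zx : (fun j => (z j 0)%:~R : R) = (fun j => (x j)%:R).
      by apply: funext => j; rewrite ffunE; have := zb j; rewrite !inE => /orP[]/eqP ->.
    apply/mapP; exists x; last by rewrite vE zx.
    by rewrite mem_enum -bool_in_ball -zx.
  move=> /mapP[x]; rewrite mem_enum -bool_in_ball => xr ->; split.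
    exists (\col_j (x j)%:Z); rewrite subrK; congr (_ *m _).
    by apply/matrixP => i j; rewrite !mxE.
  by rewrite lp_norm_le_ball_radius.
rewrite SE /counting asboolT; last exact: finite_fset.
by rewrite set_fsetK card_fseq undup_id ?size_map -?cardE// map_inj_uniq ?enum_uniq.
Qed.

End LatticeInstance.

(** * The reduction circuits *)

Section Reg.
Variables (n m k l : nat).

(* Contents: [One] 1; [Half] half of the diagonal entry of the last n rows; [RV s]
   and [RU] the row of V and u selected by the row index; [Bit] and [Occ] copies
   of qubits; [Chain T i] whether the first i input bits match pattern [T];
   [Cnt w i s] whether s of the first i variables occur in clause w; [Coef],
   [Sgn], [Ent], [Row] and [Box] the parts of the resulting entry [Res]. *)
Inductive reg :=
  | One | Half | RU | Res
  | RV of 'I_k | Bit of 'I_l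
  | Row of 'I_m | Box of 'I_n
  | Occ of 'I_m & 'I_n & bool
  | Chain of 'I_m + ('I_n + 'I_n) & 'I_l.+1
  | Cnt of 'I_m & 'I_n.+1 & 'I_k
  | Coef of 'I_m & 'I_n | Sgn of 'I_m & 'I_n | Ent of 'I_m & 'I_n.

(** A sum of products of finite types, from which [reg] inherits finiteness and its cardinality. *)
Definition reg_code : Type :=
  'I_4 + ('I_k + 'I_l + 'I_m + 'I_n) +
  ('I_m * 'I_n * bool + ('I_m + ('I_n + 'I_n)) * 'I_l.+1 + 'I_m * 'I_n.+1 * 'I_k) +
  'I_3 * ('I_m * 'I_n).

Definition encode_reg (z : reg) : reg_code :=
  match z with
  | One => inl (inl (inl (@Ordinal 4 0 isT)))
  | Half => inl (inl (inl (@Ordinal 4 1 isT)))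
  | RU => inl (inl (inl (@Ordinal 4 2 isT)))
  | Res => inl (inl (inl (@Ordinal 4 3 isT)))
  | RV s => inl (inl (inr (inl (inl (inl s)))))
  | Bit i => inl (inl (inr (inl (inl (inr i)))))
  | Row w => inl (inl (inr (inl (inr w))))
  | Box j => inl (inl (inr (inr j)))
  | Occ w j b => inl (inr (inl (inl (w, j, b))))
  | Chain T i => inl (inr (inl (inr (T, i))))
  | Cnt w i s => inl (inr (inr (w, i, s)))
  | Coef w j => inr (@Ordinal 3 0 isT, (w, j))
  | Sgn w j => inr (@Ordinal 3 1 isT, (w, j))
  | Ent w j => inr (@Ordinal 3 2 isT, (w, j))
  end.

Definition decode_reg (c : reg_code) : reg :=
  match c with
  | inl (inl (inl i)) => nth One [:: One; Half; RU; Res] i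
  | inl (inl (inr (inl (inl (inl s))))) => RV s
  | inl (inl (inr (inl (inl (inr i))))) => Bit i
  | inl (inl (inr (inl (inr w)))) => Row w
  | inl (inl (inr (inr j))) => Box j
  | inl (inr (inl (inl (w, j, b)))) => Occ w j b
  | inl (inr (inl (inr (T, i)))) => Chain T i
  | inl (inr (inr (w, i, s))) => Cnt w i s
  | inr (i, (w, j)) => nth One [:: Coef w j; Sgn w j; Ent w j] i
  end.

Lemma encode_regK : cancel encode_reg decode_reg.
Proof. by case. Qed.

HB.instance Definition _ := Finite.copy reg (can_type encode_regK).

Lemma card_reg : #|{: reg}| =
  (4 + (k + l + m + n) + (m * n * 2 + (m + (n + n)) * l.+1 + m * n.+1 * k) +
   3 * (m * n))%N.
Proof.
have bij : bijective encode_reg.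
  exists decode_reg; first exact: encode_regK.
  case=> [[[[[|[|[|[|//]]]] i4]|[[[?|?]|?]|?]]|[[[[? ?] ?]|[? ?]]|[[? ?] ?]]]|[[[|[|[|//]]] i3] [? ?]]] //=;
  repeat congr inl; repeat congr inr; repeat congr pair; exact: val_inj.
by rewrite (bij_eq_card bij) /reg_code !(card_sum, card_prod) !card_ord card_bool.
Qed.

End Reg.
Arguments One {n m k l}.
Arguments Half {n m k l}.
Arguments RU {n m k l}.
Arguments Res {n m k l}.
Arguments RV {n m k l}.
Arguments Bit {n m k l}.
Arguments Row {n m k l}.
Arguments Box {n m k l}.
Arguments Occ {n m k l}.
Arguments Chain {n m k l}.
Arguments Cnt {n m k l}.
Arguments Coef {n m k l}.
Arguments Sgn {n m k l}.
Arguments Ent {n m k l}.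

(** * Binary expansions *)

Section Bits.

(** Induction on the number of bits: the lowest bits agree, and the halves agree by induction. *)
Lemma odd_div_exp_inj a x y : (x < 2 ^ a)%N -> (y < 2 ^ a)%N ->
  (forall b, (b < a)%N -> odd (x %/ 2 ^ b) = odd (y %/ 2 ^ b)) -> x = y.
Proof.
elim: a x y => [|a IH] x y; first by rewrite expn0 !ltnS !leqn0 => /eqP -> /eqP ->.
rewrite expnSr => xa ya E.
have E0 := E 0%N isT; rewrite !divn1 in E0.
rewrite -(odd_double_half x) -(odd_double_half y) E0; congr (_ + _.*2)%N.
rewrite -!divn2; apply: IH; rewrite ?ltn_divLR// => b ba.
by rewrite -!divnMA -!expnS; apply: E.
Qed.

(** The removed multiple of $2^a$ stays even after division by $2^b$, since $b<a$. *)
Lemma odd_modn_exp x a b : (b < a)%N -> odd ((x %% 2 ^ a) %/ 2 ^ b) = odd (x %/ 2 ^ b).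
Proof.
move=> ba; rewrite [in RHS](divn_eq x (2 ^ a)) -(subnK (ltnW ba)) expnD mulnA.
rewrite divnMDl ?expn_gt0// oddD oddM.
by rewrite -[X in odd (2 ^ X)](subnSK ba) expnS oddM !andbF.
Qed.

Lemma nth_bin L x b : (b < L)%N -> nth false (bin L x) b = odd (x %/ 2 ^ b).
Proof. by move=> bL; rewrite nth_mkseq. Qed.

Lemma size_bin L x : size (bin L x) = L.
Proof. exact: size_mkseq. Qed.

Lemma lt_exp_lg N x : (x < N)%N -> (x < 2 ^ lg N)%N.
Proof. by move=> xN; apply: leq_trans xN _; exact: up_logP. Qed.

Lemma lg_le N a : (N <= 2 ^ a)%N -> (lg N <= a)%N.
Proof. exact: up_log_min. Qed.

End Bits.

(** * The circuit for one entry of the basis or the target *)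

Section ReductionCircuit.
Context {R : realType}.
(* The index of a row occupies the first [L] of the [l] input qubits. If
   [entry] holds, the other qubits index a column and the circuit computes an
   entry of the basis; otherwise it computes an entry of the target. *)
Variables (n m k l L : nat) (entry : bool).

(* The last summand pads the index register of V and u with zeros if [L < k],
   which happens only if there are no clauses. *)
Definition anc : finType :=
  ('I_m * 'I_n * 'I_(query_qubits n m k QPhi) + 'I_k * 'I_(lg k) + 'I_k)%type.
Let Q : finType := ('I_l + anc)%type.
Let Y : finType := reg n m k l.
Implicit Types (w : 'I_m) (j : 'I_n) (s : 'I_k).

Definition qphi w j b : Q := inr (inl (inl (w, j, b))).
Definition qslot s b : Q := inr (inl (inr (s, b))).
(** The index into $V$ and $u$ consists of the $k$ lowest bits of the row index and is read in place
    from the input qubits. *)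
Definition qrow (b : 'I_k) : Q :=
  if (b < L)%N then if insub (b : nat) is Some i then inl i else inr (inr b)
  else inr (inr b).

Definition occ_bit (b : bool) : 'I_(query_qubits n m k QPhi) :=
  rshift (lg n + lg m) (if b then ord_max else ord0 : 'I_2).

(** A clause [w] prescribes the row bits from [k] on, one of the last $n$ rows prescribes all row
    bits, and a column prescribes the bits after the row index. [None] leaves a bit free. *)
Definition pattern (T : 'I_m + ('I_n + 'I_n)) (b : nat) : option bool :=
  match T with
  | inl w => if (k <= b < L)%N then Some (odd (w %/ 2 ^ (b - k))) else None
  | inr (inl j) => if (b < L)%N then Some (odd ((m * 2 ^ k + j) %/ 2 ^ b)) else None
  | inr (inr j) => if (L <= b)%N then Some (odd (j %/ 2 ^ (b - L))) else None
  end.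

Notation widen := (widen_ord (leqnSn _)).

Definition opred q (s : 'I_q) : 'I_q := Ordinal (leq_ltn_trans (leq_pred s) (ltn_ord s)).

(** A factor [One] makes a copy. [Chain] multiplies in one bit test at a time. [Cnt] follows
    $[r'=s]=[r=s](1-o)+[r=s-1]o$, where $o$ tells whether the variable occurs. [Occ w j false] is 1
    for both signs, so [Sgn] is the positive minus the negative indicator for the basis and minus
    the negative one for the target. In [Box], [entry.+1] copies give $2(m+1)$ or $m+1$. *)
Definition terms (z : Y) : seq (bool * term Q Y) :=
  match z with
  | One => [:: (false, TInc)]
  | Half => nseq m.+1 (false, TInc)
  | RV _ | RU => [::]
  | Bit i => [:: (false, TBit (inl i) One)]
  | Occ w j b => [:: (false, TBit (qphi w j (occ_bit b)) One)]
  | Chain T i =>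
      if unlift ord0 i is Some b then
        let c := Chain T (widen b) in
        match pattern T b with
        | None => [:: (false, TMul c One)]
        | Some true => [:: (false, TMul c (Bit b))]
        | Some false => [:: (false, TMul c One); (true, TMul c (Bit b))]
        end
      else [:: (false, TInc)]
  | Cnt w i s =>
      if unlift ord0 i is Some j then
        let c := Cnt w (widen j) in
        [:: (false, TMul (c s) One); (true, TMul (c s) (Occ w j false))] ++
        nseq (s != 0 :> nat) (false, TMul (c (opred s)) (Occ w j false))
      else nseq (s == 0 :> nat) (false, TInc)
  | Coef w j => [seq (false, TMul (Cnt w (widen j) s) (RV s)) | s <- enum 'I_k]
  | Sgn w j => rcons (nseq entry.+1 (false, TMul (Occ w j true) One))
                 (true, TMul (Occ w j false) One)
  | Ent w j => [:: (false, TMul (Sgn w j) (Chain (inr (inr j)) ord_max))]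
  | Row w => nseq (~~ entry) (false, TMul RU One) ++
             [seq (false, TMul (Ent w j) (Coef w j)) | j <- enum 'I_n]
  | Box j => nseq entry.+1 (false, TMul Half (Chain (inr (inr j)) ord_max))
  | Res => [seq (false, TMul (Chain (inl w) ord_max) (Row w)) | w <- enum 'I_m] ++
           [seq (false, TMul (Chain (inr (inl j)) ord_max) (Box j)) | j <- enum 'I_n]
  end.

Definition rk (z : Y) : nat :=
  match z with
  | One | Half | RV _ | RU => 0
  | Bit _ | Occ _ _ _ => 1
  | Chain _ i => i.+2
  | Cnt _ i _ => i.+2
  | Sgn _ _ => 2
  | Coef _ _ => n + 4
  | Ent _ _ | Box _ => l + 4
  | Row _ => n + l + 5
  | Res => n + l + 6
  end.

Lemma terms_wf : slp_wf terms rk.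
Proof.
case=> [||||s|i|w|j|w j b|T i|w i s|w j|w j|w j] //=.
- by rewrite all_nseq orbT.
- by rewrite all_cat !all_map; apply/andP; split; apply/allP => x _ /=; lia.
- rewrite all_cat all_nseq all_map /=; apply/andP; split; first by rewrite !addn_gt0 !orbT.
  by apply/allP => j _ /=; lia.
- by case: entry => /=; lia.
- case: unliftP => [i' ->|-> //]; case: (pattern T i') => [[]|] /=; rewrite /bump /=; lia.
- by case: unliftP => [i' ->|->] /=; rewrite ?all_nseq /= /bump /=; lia.
- by rewrite all_map; apply/allP => s _ /=; have := ltn_ord j; lia.
- by case: entry.
- lia.
Qed.

Let X : finType := option Y.
Let prog := seq (ninstr n m k Q X).

(** * Loading the oracle answers *)

Definition flip (q : Q) : ninstr n m k Q X :=
  @NInstr n m k Q X (inl GX) false (tnth [tuple q]) (tnth [tuple]).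

Lemma step_flip (p : R) O q (c : memory R Q X) :
  step p O (flip q) c (upd c.1 q (~~ c.1 q), c.2).
Proof.
split=> //=; [by move=> i i' _; rewrite !ord1|by case| |].
  set d := nread _ _ c.
  rewrite (_ : nread _ _ _ = xor_bit (inord 0) true d); first exact: xor_op_maps.
  congr pair; apply/ffunP => j; rewrite !ffunE //=.
  by rewrite !(ord1 j) (ord1 (inord 0)) !(tnth_nth q) /= /upd eqxx addbT.
move=> x xq; rewrite /upd; case: eqP => // xE.
by case/negP: xq; apply/codomP; exists ord0; rewrite xE (tnth_nth q).
Qed.

Lemma exec_flips (p : R) O (s : seq Q) (b : Q -> bool) (r : X -> R) : uniq s ->
  exec p O (map flip s) (b, r) (fun q => b q (+) (q \in s), r).
Proof.
elim: s b => [|q s IH] b /=.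
  by move=> _; congr pair; apply: funext => q; rewrite addbF.
move=> /andP[qs us]; eexists; first exact: step_flip.
have := IH (upd b q (~~ b q)) us; congr exec; congr pair; apply: funext => q' /=.
rewrite /upd in_cons; case: eqP => [->|//] /=; by rewrite (negPf qs) addbF addbT.
Qed.

Definition index_bits w j : seq bool := bin (lg n) j ++ bin (lg m) w.

(** Apart from the row index, all query addresses are known in advance, so X gates can prepare
    them. *)
Definition anc_const (a : anc) : bool :=
  match a with
  | inl (inl (w, j, b)) => nth false (index_bits w j) b
  | inl (inr (s, b)) => nth false (bin (lg k) s) b
  | inr _ => false
  end.

Definition load_consts : prog := [seq flip (inr a) | a <- enum anc & anc_const a].

Definition query_clause (wj : 'I_m * 'I_n) : ninstr n m k Q X :=
  @NInstr n m k Q X (inr QPhi) false (qphi wj.1 wj.2) (tnth [tuple]).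

Definition query_V s : ninstr n m k Q X :=
  @NInstr n m k Q X (inr QV) false
    (fun b => match fintype.split b with inl b => qrow b | inr b => qslot s b end)
    (tnth [tuple Some (RV s)]).

Definition query_u : ninstr n m k Q X :=
  @NInstr n m k Q X (inr Qu) false qrow (tnth [tuple Some RU]).

Definition load : prog :=
  load_consts ++ map query_clause (enum {: 'I_m * 'I_n}) ++
  map query_V (enum 'I_k) ++ [:: query_u].

Lemma size_load : (size load <= #|anc| + m * n + k + 1)%N.
Proof.
rewrite !size_cat !size_map /= -!enumT -!cardT card_prod !card_ord !addnA !leq_add2r.
by rewrite size_filter (leq_trans (count_size _ _))// cardT.
Qed.

Variables (V : 'M[R]_(2 ^ k, k)) (u : 'cV[R]_(2 ^ k)) (psi : cnf n m).
Variables (p : R) (O : oracles R n m k).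
Hypothesis OP : oracles_for V u psi O.
Variables (inp : seq bool) (h : nat).
Hypothesis inp_row : forall b, (b < L)%N -> nth false inp b = odd (h %/ 2 ^ b).
Hypothesis hL : (h < 2 ^ L)%N.
Hypothesis Ll : (L <= l)%N.

(** [done] lists the pairs already queried, which makes this a prefix invariant for
    [exec_flatten]. *)
Definition loaded_bits (done : seq ('I_m * 'I_n)) (q : Q) : bool :=
  match q with
  | inl i => nth false inp i
  | inr (inl (inl (w, j, b))) =>
      nth false (index_bits w j ++
        if (w, j) \in done then occ_code (psi w j) else [::]) b
  | inr a => anc_const a
  end.

Definition loaded_reals (done : seq 'I_k) (z : Y) : R :=
  if z is RV s then (if s \in done then V (low k h) s else 0) else 0.

Definition loaded (z : Y) : R :=
  match z with RV s => V (low k h) s | RU => u (low k h) 0 | _ => 0 end.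

Lemma step_query (x : query) (f : 'I_(query_qubits n m k x) -> Q)
    (g : 'I_(query_reals x) -> X) (c c' : memory R Q X) :
    injective f -> injective g ->
    fwd (O x) (ket (nread f g c)) = ket (nread f g c') ->
    (forall q, q \notin codom f -> c.1 q = c'.1 q) ->
    (forall y, y \notin codom g -> c.2 y = c'.2 y) ->
  step p O (@NInstr n m k Q X (inr x) false f g) c c'.
Proof. by move=> fi gi E c1 c2; split=> //=; apply: unitary_maps => //; case: OP. Qed.

Lemma qrow_inj : injective qrow.
Proof.
move=> b b'; rewrite /qrow; case: ifP => _; case: ifP => _.
- case: insubP => [i _ ib|_]; case: insubP => [i' _ ib'|_] //; last by case.
  by case=> E; apply: val_inj; rewrite -[LHS]ib -[RHS]ib' E.
- by case: insubP => // _ [].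
- by case: insubP => // _ [].
- by case.
Qed.

(** Reduction modulo $2^k$ keeps the bits below $k$, and the bits from $L$ on vanish since
    $h<2^L$. *)
Lemma loaded_bits_qrow done (b : 'I_k) :
  loaded_bits done (qrow b) = odd (low k h %/ 2 ^ b).
Proof.
rewrite /= odd_modn_exp// /qrow; case: ifP => [bL|/negbT].
  by rewrite insubT ?(leq_trans bL)//= => bl; exact: inp_row.
rewrite -leqNgt => Lb /=; rewrite divn_small//.
by apply: leq_trans hL _; rewrite leq_exp2l.
Qed.

Lemma exec_load_consts o :
  exec p O load_consts (start l anc Y inp o) (loaded_bits [::], regs o (fun=> 0)).
Proof.
have := @exec_flips p O [seq inr a | a <- enum anc & anc_const a]
  (start l anc Y inp o).1 (start l anc Y inp o).2.
rewrite -map_comp map_inj_uniq; last by move=> ? ? [].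
move=> /(_ (filter_uniq _ (enum_uniq _))); rewrite -surjective_pairing.
congr exec; congr pair; apply: funext => -[i|a] /=.
  rewrite (_ : _ \in _ = false) ?addbF//; by apply/negbTE/mapP => -[].
rewrite mem_map; last by move=> ? ? [].
rewrite mem_filter mem_enum andbT.
by case: a => [[[[w j] b]|[s b]]|b] //=; rewrite cats0.
Qed.

Lemma exec_query_clauses o : exec p O (map query_clause (enum {: 'I_m * 'I_n}))
  (loaded_bits [::], regs o (fun=> 0))
  (loaded_bits (enum {: 'I_m * 'I_n}), regs o (fun=> 0)).
Proof.
have -> P : map query_clause P = flatten (map (fun wj => [:: query_clause wj]) P).
  by elim: P => //= wj P ->.
apply: (@exec_flatten _ _ _ _ _ _ p O _ _
  (fun done => (loaded_bits done, regs o (fun=> 0)))) => s1 [w j] s2 sE.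
have wjs1 : (w, j) \notin s1.
  have := enum_uniq {: 'I_m * 'I_n}.
  by rewrite sE cat_uniq /= negb_or => /and3P[_ /andP[]].
apply: exec1; apply: step_query.
- by move=> b b' [].
- by case.
(* Before the query, the default value of [nth] stands for the answer qubits being 0. *)
- have rd done : nread (qphi w j) (tnth [tuple])
      (loaded_bits done, regs o (fun=> 0)) =
    conf _ _ (index_bits w j ++
      if (w, j) \in done then occ_code (psi w j) else [::]) [::] :> config R _ 0.
    by congr pair; apply/ffunP => b; rewrite !ffunE //; case: b.
  rewrite !rd mem_rcons mem_head (negPf wjs1) cats0.
  by rewrite /index_bits -catA; case: OP => _ _ _ ->.
- case=> // -[[[[w' j'] b]|]|] //= qw; rewrite mem_rcons in_cons.
  case: eqP => [[E1 E2]|//]; case/negP: qw; rewrite E1 E2; exact: codom_f.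
- by [].
Qed.

Lemma exec_query_Vs o done : exec p O (map query_V (enum 'I_k))
  (loaded_bits done, regs o (fun=> 0))
  (loaded_bits done, regs o (loaded_reals (enum 'I_k))).
Proof.
have -> P : map query_V P = flatten (map (fun s => [:: query_V s]) P).
  by elim: P => //= s P ->.
have {1}-> : (fun=> 0) = loaded_reals [::] by apply: funext => -[].
apply: (@exec_flatten _ _ _ _ _ _ p O _ _
  (fun t => (loaded_bits done, regs o (loaded_reals t)))) => s1 s s2 sE.
have ss1 : s \notin s1.
  have := enum_uniq 'I_k.
  by rewrite sE cat_uniq /= negb_or => /and3P[_ /andP[]].
apply: exec1; apply: step_query.
- move=> b b'; case: splitP => i bi; case: splitP => i' bi' //=.
  + by move=> /qrow_inj E; apply: val_inj; rewrite [LHS]bi [RHS]bi' E.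
  + by rewrite /qrow; case: ifP => // _; case: insubP.
  + by rewrite /qrow; case: ifP => // _; case: insubP.
  + by case=> E; apply: val_inj; rewrite [LHS]bi [RHS]bi' E.
- by move=> i i' _; rewrite !ord1.
- have rd (s' : seq 'I_k) : nread (fun b => match fintype.split b with inl b => qrow b | inr b => qslot s b end)
      (tnth [tuple Some (RV s)]) (loaded_bits done, regs o (loaded_reals s')) =
    conf _ _ (bin k (low k h) ++ bin (lg k) s) [:: if s \in s' then V (low k h) s else 0].
    congr pair; apply/ffunP => b; rewrite !ffunE /=.
      rewrite nth_cat size_bin; case: splitP => i bi; rewrite [nat_of_ord b]bi.
        by rewrite loaded_bits_qrow nth_bin.
      by rewrite addKn.
    by rewrite (ord1 b) (tnth_nth None).
  by rewrite !rd mem_rcons mem_head (negPf ss1); case: OP => _ ->.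
- by [].
- case=> // -[] //= s' sV; rewrite mem_rcons in_cons; case: eqP => [E|//].
  by case/negP: sV; apply/codomP; exists ord0; rewrite E (tnth_nth None).
Qed.

Lemma exec_query_u o done :
  exec p O [:: query_u] (loaded_bits done, regs o (loaded_reals (enum 'I_k)))
    (loaded_bits done, regs o loaded).
Proof.
apply: exec1; apply: step_query.
- exact: qrow_inj.
- by move=> i i' _; rewrite !ord1.
- have rd v : nread qrow (tnth [tuple Some RU]) (loaded_bits done, regs o v) =
      conf _ _ (bin k (low k h)) [:: v RU].
    congr pair; apply/ffunP => b; rewrite !ffunE /=.
      by rewrite loaded_bits_qrow nth_bin.
    by rewrite (ord1 b) (tnth_nth None).
  by rewrite !rd; case: OP => _ _ ->.
- by [].
- case=> // -[] //= => [uU|s _]; last by rewrite mem_enum.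
  by case/negP: uU; apply/codomP; exists ord0; rewrite (tnth_nth None).
Qed.

Lemma exec_load o : exec p O load (start l anc Y inp o)
  (loaded_bits (enum {: 'I_m * 'I_n}), regs o loaded).
Proof.
apply: exec_cat (exec_load_consts o) _; apply: exec_cat (exec_query_clauses o) _.
exact: exec_cat (exec_query_Vs o _) (exec_query_u o _).
Qed.

(** * Values of the registers and correctness of the result *)

Definition matches T (i : nat) : bool :=
  all (fun b => if pattern T b is Some c then nth false inp b == c else true) (iota 0 i).

(** Without column bits, as for the target, the match is vacuous and the value is 1, so the same
    formulas then sum over all columns. *)
Definition column j : R := (matches (inr (inr j)) l)%:R.
Definition sign w j : R := pos (psi w j) *+ entry - neg (psi w j).
Definition row_value w : R := u (low k h) 0 *+ ~~ entry +
  \sum_j sign w j * column j * coef V psi (low k h) w j.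
Definition box_value j : R := (margin m : R) * column j *+ entry.+1.

Definition value (z : Y) : R :=
  match z with
  | One => 1
  | Half => margin m
  | RV s => V (low k h) s
  | RU => u (low k h) 0
  | Bit i => (nth false inp i)%:R
  | Occ w j b => (if b then psi w j == Some true else psi w j != None)%:R
  | Chain T i => (matches T i)%:R
  | Cnt w i s => (rank psi w i == s)%:R
  | Coef w j => coef V psi (low k h) w j
  | Sgn w j => sign w j
  | Ent w j => sign w j * column j
  | Row w => row_value w
  | Box j => box_value j
  | Res => \sum_w (matches (inl w) l)%:R * row_value w +
           \sum_j (matches (inr (inl j)) l)%:R * box_value j
  end.

Lemma loaded_bits_occ w j b :
  loaded_bits (enum {: 'I_m * 'I_n}) (qphi w j (occ_bit b)) =
  if b then psi w j == Some true else psi w j != None.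
Proof.
rewrite /= mem_enum nth_cat /index_bits size_cat !size_bin ltnNge leq_addr /= addKn.
by case: b.
Qed.

(** These are the equations required by [exec_slp]; apart from plain sums, they are identities
    between indicators, checked by cases. *)
Lemma valueE z :
  value z = loaded z + term_sum p (loaded_bits (enum {: 'I_m * 'I_n})) value (terms z).
Proof.
case: z => [||||s|i|w|j|w j b|T i|w i s|w j|w j|w j];
  rewrite [value _]/= [loaded _]/= [terms _]/= ?add0r.
- by rewrite !term_sumE /= mul1r addr0.
- by rewrite -[_ :: _]/(nseq m.+1 _) !term_sumE /= mul1r.
- by rewrite term_sumE addr0.
- by rewrite !term_sumE.
- by rewrite term_sumE addr0.
- by rewrite !term_sumE /= mul1r mulr1 addr0.
- rewrite !term_sumE /= /row_value mul1r mulr1; congr (_ + _).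
- by rewrite -[_ :: _]/(nseq entry.+1 _) !term_sumE /= mul1r.
- rewrite !term_sumE mul1r addr0.
  transitivity ((loaded_bits (enum {: 'I_m * 'I_n}) (qphi w j (occ_bit b)))%:R * 1 : R) => //.
  by rewrite mulr1 loaded_bits_occ.
- case: unliftP => [b ->|->]; last by rewrite !term_sumE /= mul1r addr0.
  have -> : matches T (lift ord0 b) = matches T b &&
      (if pattern T b is Some c then nth false inp b == c else true).
    by rewrite /matches lift0 -addn1 iotaD all_cat /= andbT.
  case: (pattern T b) => [[]|]; rewrite !term_sumE /= ?expr0 ?expr1;
    case: (matches T b); case: (nth false inp b) => /=; ring.
- case: unliftP => [j ->|->]; last first.
    by rewrite term_sumE /= /rank big1 // mul1r eq_sym; case: eqP.
  rewrite lift0 rankS !term_sumE /= ?expr0 ?expr1.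
  (* Slot 0 has no predecessor, so the [opred] term is present only for positive [s]. *)
  have [s0|s0] := eqVneq (s : nat) 0%N.
    rewrite s0; case: (psi w j != None); case: (rank psi w j) => [|r] /=; ring.
  rewrite -(prednK (_ : 0 < s)%N) ?lt0n//=.
  case: (psi w j != None); rewrite ?addn1 ?addn0 ?eqSS /= ; ring.
- by rewrite !term_sumE; apply: eq_bigr.
- rewrite -?cats1 !term_sumE /= /sign /pos /neg expr0 expr1.
  by case: (psi w j) => [[]|]; case: entry => /=; ring.
- by rewrite !term_sumE /= mul1r addr0.
Qed.

(** The tested bits are the $L-k$ lowest bits of $\lfloor h/2^k\rfloor$, and both this number and
    $w$ are below $2^{L-k}$. *)
Lemma matches_clause w : (m * 2 ^ k <= 2 ^ L)%N ->
  matches (inl w) l = (h %/ 2 ^ k == w)%N.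
Proof.
move=> mkL.
(* A clause [w] exists, so $m\ge1$ and $2^k\le m2^k\le2^L$. *)
have kL : (k <= L)%N.
  rewrite -(leq_exp2l (m := 2))//; apply: leq_trans mkL; apply: leq_pmull.
  exact: leq_ltn_trans (ltn_ord w).
have bit b : (k <= b)%N -> odd (h %/ 2 ^ b) = odd ((h %/ 2 ^ k) %/ 2 ^ (b - k)).
  by move=> kb; rewrite -divnMA -expnD subnKC.
apply/allP/eqP => [E|E b].
  apply: (@odd_div_exp_inj (L - k)) => [||b bL].
  - by rewrite ltn_divLR ?expn_gt0// -expnD subnK.
  - apply: leq_trans (ltn_ord w) _.
    by rewrite -(@leq_pmul2r (2 ^ k)) ?expn_gt0// -expnD subnK.
  have kbL : (k + b < L)%N by rewrite -ltn_subRL.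
  have /= := E (k + b)%N; rewrite mem_iota add0n (leq_trans kbL)// => /(_ isT).
  by rewrite leq_addr kbL /= addKn inp_row// bit ?leq_addr// addKn => /eqP.
rewrite mem_iota /= => bl; case: ifP => // /andP[kb bL].
by rewrite inp_row// bit// E.
Qed.

Lemma matches_box j : (m * 2 ^ k + n <= 2 ^ L)%N ->
  matches (inr (inl j)) l = (h == m * 2 ^ k + j)%N.
Proof.
move=> NL; apply/allP/eqP => [E|E b]; last first.
  by rewrite mem_iota /= => bl; case: ifP => // bL; rewrite inp_row// E.
apply: (@odd_div_exp_inj L) => // [|b bL].
  by apply: leq_trans NL; rewrite ltn_add2l.
have /= := E b; rewrite mem_iota add0n (leq_trans bL)// => /(_ isT).
by rewrite bL inp_row// => /eqP.
Qed.

Lemma matches_column j (j0 : 'I_n) : l = (L + lg n)%N ->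
    (forall b, (b < lg n)%N -> nth false inp (L + b) = odd (j0 %/ 2 ^ b)) ->
  matches (inr (inr j)) l = (j0 == j).
Proof.
move=> lE inp_col; apply/allP/eqP => [E|<- b]; last first.
  rewrite mem_iota /= lE => bl; case: ifP => // Lb.
  by rewrite -{1}(subnKC Lb) inp_col// ltn_subLR.
apply: val_inj; apply: (@odd_div_exp_inj (lg n)) => [||b bn]; [exact: lt_exp_lg (ltn_ord j0)|exact: lt_exp_lg (ltn_ord j)|].
have /= := E (L + b)%N; rewrite mem_iota add0n lE ltn_add2l bn => /(_ isT).
by rewrite leq_addr addKn inp_col// => /eqP.
Qed.

Lemma column_eq1 j : l = L -> column j = 1.
Proof.
move=> lE; rewrite /column [matches _ _](_ : _ = true)//; apply/allP => b.
by rewrite mem_iota add0n /= lE => bL; rewrite leqNgt bL.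
Qed.

(** The column indicators collapse the sums over columns to the single column [j0]. *)
Lemma value_entry (h0 : 'I_(m * 2 ^ k + n)) (j0 : 'I_n) :
    entry -> h = h0 -> L = lg (m * 2 ^ k + n) -> l = (L + lg n)%N ->
    (forall b, (b < lg n)%N -> nth false inp (L + b) = odd (j0 %/ 2 ^ b)) ->
  value Res = cnf_basis V psi h0 j0.
Proof.
move=> en hE LE lE inp_col.
have NL : (m * 2 ^ k + n <= 2 ^ L)%N by rewrite LE; exact: up_logP.
have colE j : column j = (j0 == j)%:R by rewrite /column (matches_column _ lE inp_col).
rewrite mxE -hE /=; congr (_ + _).
  apply: eq_bigr => w _; rewrite matches_clause ?(leq_trans (leq_addr _ _) NL)//.
  congr (_ * _); rewrite /row_value en mulr0n add0r (bigD1 j0)//= big1 => [|j /negPf jj].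
    by rewrite colE eqxx mulr1 addr0 /sign en mulr1n.
  by rewrite colE eq_sym jj mulr0 mul0r.
rewrite (bigD1 j0)//= big1 => [|j /negPf jj].
  rewrite matches_box// /box_value colE eqxx en addr0 mulr1.
  by congr (_ * _); rewrite mulr_natl.
by rewrite /box_value colE eq_sym jj mulr0 mul0rn mulr0.
Qed.

Lemma value_target (h0 : 'I_(m * 2 ^ k + n)) :
    ~~ entry -> h = h0 -> L = lg (m * 2 ^ k + n) -> l = L ->
  value Res = cnf_target V u psi h0 0.
Proof.
move=> /negPf en hE LE lE.
have NL : (m * 2 ^ k + n <= 2 ^ L)%N by rewrite LE; exact: up_logP.
rewrite mxE -hE /=; congr (_ + _).
  apply: eq_bigr => w _; rewrite matches_clause ?(leq_trans (leq_addr _ _) NL)//.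
  congr (_ * _); rewrite /row_value en mulr1n; congr (_ + _); rewrite -sumrN.
  by apply: eq_bigr => j _; rewrite column_eq1// mulr1 /sign en mulr0n sub0r mulNr.
by apply: eq_bigr => j _; rewrite matches_box// /box_value column_eq1// mulr1 en mulr1n.
Qed.

Definition reduction_circuit : circuit n m k l :=
  slp_circuit load terms rk One Res.

Lemma reduction_circuit_outputs :
  (size inp <= l)%N -> outputs p O reduction_circuit inp (value Res).
Proof.
move=> sl; apply: (slp_circuit_outputs _ sl exec_load terms_wf valueE) => //.
by case: OP.
Qed.

End ReductionCircuit.

(** * The radius and the costs *)

Inductive radius_reg := ROne | RMargin | RPow | RSum | RRoot.

Definition encode_radius_reg (z : radius_reg) : 'I_5 :=
  match z with
  | ROne => @Ordinal 5 0 isT | RMargin => @Ordinal 5 1 isT | RPow => @Ordinal 5 2 isT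
  | RSum => @Ordinal 5 3 isT | RRoot => @Ordinal 5 4 isT
  end.

Lemma encode_radius_regK :
  cancel encode_radius_reg (nth ROne [:: ROne; RMargin; RPow; RSum; RRoot]).
Proof. by case. Qed.

HB.instance Definition _ := Finite.copy radius_reg (can_type encode_radius_regK).

Section RadiusCircuit.
Context {R : realType}.
Variables (n m k : nat).
Let Q : finType := ('I_0 + void)%type.

(** Increments and repeated additions produce $m+1$, $m$ and the factor $n$, at a cost linear in
    $n+m$. *)
Definition radius_terms (z : radius_reg) : seq (bool * term Q radius_reg) :=
  match z with
  | ROne => [:: (false, TInc)]
  | RMargin => nseq m.+1 (false, TInc)
  | RPow => [:: (false, TPow RMargin)]
  | RSum => nseq m (false, TInc) ++ nseq n (false, TMul RPow ROne)
  | RRoot => [:: (false, TRoot RSum)]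
  end.

Definition radius_value (p : R) (z : radius_reg) : R :=
  match z with
  | ROne => 1 | RMargin => margin m | RPow => margin m `^ p
  | RSum => ball_radius_pow n m p | RRoot => ball_radius n m p
  end.

Definition radius_circuit : circuit n m k 0 :=
  slp_circuit [::] radius_terms (fun z => encode_radius_reg z) ROne RRoot.

Lemma radius_circuit_outputs (p : R) (O : oracles R n m k) :
  (forall x, unitary (O x)) -> outputs p O radius_circuit [::] (ball_radius n m p).
Proof.
move=> uO.
apply: (@slp_circuit_outputs _ _ _ _ _ _ _ _ _ _ _ _ p O [::]
  (start 0 void radius_reg [::] (0 : R)).1 (fun=> 0) (radius_value p)) => //.
  by case=> //=; rewrite ?all_cat ?all_nseq //= ?orbT.
case; rewrite [radius_value _ _]/= [radius_terms _]/= add0r.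
- by rewrite !term_sumE mul1r addr0.
- by rewrite -[_ :: _]/(nseq m.+1 _) !term_sumE mul1r.
- by rewrite !term_sumE mul1r addr0 /= gtr0_norm ?margin_gt0.
- by rewrite !term_sumE /= !mul1r mulr1 /ball_radius_pow mulr_natl.
- rewrite !term_sumE mul1r addr0 /= ger0_norm//.
  by rewrite addr_ge0 ?mulr_ge0 ?ler0n ?powR_ge0.
Qed.

Lemma cost_radius_circuit : (cost radius_circuit <= 4 * (n + m) + 11)%N.
Proof.
apply: leq_trans (cost_slp_circuit _ _ _ _ _) _ => /=.
rewrite (reindex (nth ROne [:: ROne; RMargin; RPow; RSum; RRoot] \o @nat_of_ord 5)) /=.
  rewrite !big_ord_recl big_ord0 /= size_cat !size_nseq; lia.
exists encode_radius_reg => [i _|z _]; last exact: encode_radius_regK.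
by case: i => [[|[|[|[|[|//]]]]] i5]; apply: val_inj.
Qed.

End RadiusCircuit.

(** * Polynomial cost bounds *)

Lemma lg_le_id n : (lg n <= n)%N.
Proof. by apply: lg_le; exact: ltnW (ltn_expl _ _). Qed.

(** Both $m2^k\le2^m2^n$ and $n\le2^n$ are at most $2^{n+m}$. *)
Lemma lg_rows_le n m k : (k <= n)%N -> (lg (m * 2 ^ k + n) <= (n + m).+1)%N.
Proof.
move=> kn; apply: lg_le; rewrite expnS mul2n -addnn; apply: leq_add.
  rewrite mulnC expnD; apply: leq_mul; first by rewrite leq_exp2l.
  exact: ltnW (ltn_expl _ _).
apply: leq_trans (ltnW (ltn_expl n (ltnSn 1))) _.
by rewrite leq_exp2l// leq_addr.
Qed.

(** Put $a=4(n+m)$. Loading costs at most $6a^3$, and at most $12a^3$ registers have at most $a$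
    terms each. Computing, copying and uncomputing then give $2(6a^4+12a^4)+1\le37a^4$. *)
Lemma cost_reduction_circuit n m k l L entry :
    (3 <= k)%N -> (k <= n)%N -> (l < 4 * (n + m))%N ->
  (cost (reduction_circuit n m k l L entry) <= 37 * (4 * (n + m)) ^ 4)%N.
Proof.
set a := (4 * (n + m))%N => k3 kn la.
apply: leq_trans (cost_slp_circuit _ _ _ _ _) _.
have terms_le z : (size (@terms n m k l L entry z) <= a)%N.
  have kN : (3 <= n)%N by exact: leq_trans kn.
  case: z => [||||s|i|w|j|w j b|T i|w i s|w j|w j|w j] /=;
    rewrite ?size_cat ?size_map ?size_rcons ?size_nseq -?enumT -?cardT ?card_ord /=; try lia.
  - case: unliftP => [b _|_] /=; last lia.
    by case: (pattern _ _ _) => [[]|] /=; lia.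
  - case: unliftP => [b _|_] /=; rewrite ?size_nseq; lia.
have sum_le : (\sum_z size (@terms n m k l L entry z) <= #|{: reg n m k l}| * a)%N.
  by rewrite -sum_nat_const; apply: leq_sum.
have ln := lg_le_id n; have lm := lg_le_id m; have lk := lg_le_id k.
have cube x y z : (x <= a)%N -> (y <= a)%N -> (z <= a)%N -> (x * y * z <= a ^ 3)%N.
  by move=> xa ya za; rewrite !expnS expn0 muln1 mulnA !leq_mul.
have a1 : (1 <= a)%N by lia.
have single x : (x <= a)%N -> (x <= a ^ 3)%N.
  by move=> xa; have := cube x 1%N 1%N xa a1 a1; rewrite !muln1.
have double x y : (x <= a)%N -> (y <= a)%N -> (x * y <= a ^ 3)%N.
  by move=> xa ya; have := cube x y 1%N xa ya a1; rewrite muln1.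
have reg_le : (#|{: reg n m k l}| <= 12 * a ^ 3)%N.
  rewrite card_reg.
  have := single 4; have := single k; have := single l; have := single m.
  have := single n; have := double m n; have := double (m + (n + n))%N l.+1.
  have := cube m n.+1 k; lia.
have load_le : (size (load n m k l L) <= 6 * a ^ 3)%N.
  apply: leq_trans (size_load _ _ _ _ _) _.
  rewrite /anc !(card_sum, card_prod) !card_ord /=.
  have := cube m n (lg n + lg m + 2)%N; have := double k (lg k).
  have := single k; have := double m n; have := single 1%N; lia.
have a34 : (a ^ 3 <= a ^ 4)%N by rewrite leq_exp2l//; lia.
have reg_le4 : (#|{: reg n m k l}| * a <= 12 * a ^ 4)%N.
  by rewrite (expnSr a 3) mulnA leq_mul2r reg_le orbT.
have a4 : (1 <= a ^ 4)%N by rewrite expn_gt0 a1.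
lia.
Qed.

Theorem theorem5p4 (R : realType) :
  exists c : nat,
  forall (n m k : nat) (p : R), (3 <= k)%N -> (k <= n)%N -> 1 <= p ->
  exists (CB : circuit n m k (lg (m * 2 ^ k + n) + lg n))
         (Ct : circuit n m k (lg (m * 2 ^ k + n)))
         (Cr : circuit n m k 0),
  (cost CB + cost Ct + cost Cr <= c * (n + m) ^ c)%N /\
  forall (V : 'M[R]_(2 ^ k, k)) (u : 'cV[R]_(2 ^ k)), isolating p V u ->
  forall psi : cnf n m, is_kcnf k psi ->
  forall O : oracles R n m k, oracles_for V u psi O ->
  exists (B : 'M[R]_(m * 2 ^ k + n, n)) (t : 'cV[R]_(m * 2 ^ k + n)) (r : R),
  [/\ is_basis B /\ 0 < r,
      forall (h : 'I_(m * 2 ^ k + n)) (j : 'I_n),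
        outputs p O CB
          (bin (lg (m * 2 ^ k + n)) h ++ bin (lg n) j) (B h j),
      forall h : 'I_(m * 2 ^ k + n),
        outputs p O Ct (bin (lg (m * 2 ^ k + n)) h) (t h 0),
      outputs p O Cr [::] r &
      (#|sol psi|%:R)%:E = VCP p B t r].
Proof.
(* As $n+m\ge3$, $12(n+m)^{12}\ge12\cdot3^7(n+m)^4$, which exceeds the total
   $2\cdot37\cdot4^4(n+m)^4+4(n+m)+11$. *)
exists 12%N => n m k p k3 kn p1; set L := lg (m * 2 ^ k + n).
exists (reduction_circuit n m k (L + lg n) L true),
  (reduction_circuit n m k L L false), (radius_circuit n m k); split.
  have n3 : (3 <= n)%N by exact: leq_trans kn.
  have Lle : (L <= (n + m).+1)%N by exact: lg_rows_le.
  have nle := lg_le_id n.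
  have cB : (cost (reduction_circuit n m k (L + lg n) L true) <= 37 * (4 * (n + m)) ^ 4)%N.
    by apply: cost_reduction_circuit => //; lia.
  have ct : (cost (reduction_circuit n m k L L false) <= 37 * (4 * (n + m)) ^ 4)%N.
    by apply: cost_reduction_circuit => //; lia.
  have cr := cost_radius_circuit n m k.
  have N3 : (3 <= n + m)%N by lia.
  have N4 : (n + m <= (n + m) ^ 4)%N by rewrite -{1}(expn1 (n + m)) leq_exp2l; lia.
  have N7 : (3 ^ 7 * (n + m) ^ 4 <= (n + m) ^ 12)%N.
    rewrite -[12%N]/(8 + 4)%N expnD leq_mul2r; apply/orP; right.
    by apply: (@leq_trans (3 ^ 8)); rewrite ?leq_exp2l// leq_exp2r.
  rewrite expnMn in cB ct; move: cB ct cr N3 N4 N7.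
  rewrite -[(4 ^ 4)%N]/256%N -[(3 ^ 7)%N]/2187%N.
  move: ((n + m) ^ 4)%N ((n + m) ^ 12)%N => X4 X12; lia.
move=> V u Vu psi psik O OP.
have n0 : (0 < n)%N by apply: leq_trans kn; apply: leq_trans k3.
exists (cnf_basis V psi), (cnf_target V u psi), (ball_radius n m p); split.
- by split; [exact: is_basis_cnf_basis | rewrite powR_gt0// ball_radius_pow_gt0].
- move=> h j; have hL := lt_exp_lg (ltn_ord h).
  have row b : (b < L)%N -> nth false (bin L h ++ bin (lg n) j) b = odd (h %/ 2 ^ b).
    by move=> bL; rewrite nth_cat size_bin bL nth_bin.
  have col b : (b < lg n)%N ->
      nth false (bin L h ++ bin (lg n) j) (L + b) = odd (j %/ 2 ^ b).
    by move=> bn; rewrite nth_cat size_bin ltnNge leq_addr /= addKn nth_bin.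
  rewrite -(value_entry (entry := true) V u psi row hL (leq_addr (lg n) L) isT erefl erefl erefl col).
  by apply: reduction_circuit_outputs; rewrite ?size_cat ?size_bin ?leq_addr.
- move=> h; have hL := lt_exp_lg (ltn_ord h).
  have row b : (b < L)%N -> nth false (bin L h) b = odd (h %/ 2 ^ b).
    exact: nth_bin.
  rewrite -(value_target (entry := false) V u psi row hL (leqnn L) isT erefl erefl erefl).
  by apply: reduction_circuit_outputs; rewrite ?size_bin.
- by apply: radius_circuit_outputs; case: OP.
- exact: card_sol_VCP.
Qed.
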